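(* Let $A=\langle\langle a,b\rangle\rangle$ have dimension $\geq3$, where $a$ is a weakly primitive axis satisfying the fusion rules with $\dim A_0(a)=1$, and $b$ is an axis with $b_0\neq0$ (so $A_0(a)=\mathbb Fb_0$). Put $S=S(a)$, $S^\circ=S^\circ(a)$, $S^\dagger=S^\dagger(a)$. Let $\rho\neq\frac12$ and let $y=\alpha_ya+\gamma_0b_0+\sum_{(\mu,\nu)\in S^\circ}\gamma_{\mu,\nu}b_{\mu,\nu}$ be a nonzero $(\rho,\rho)$-eigenvector of $b$. Write $\varepsilon_{\mu,\nu}=\mu+\nu$, $\sum_{(\mu,\nu)\in S}\mu b_{\mu,\nu}^2=\theta_1a+\theta_0b_0$ and $\sum_{(\mu,\nu)\in S}b_{\mu,\nu}^2=\theta_1'a+\theta_0'b_0$. Then $2(\theta_1a+\theta_0b_0)=\sum_{(\mu,\nu)\in S}\varepsilon_{\mu,\nu}b_{\mu,\nu}^2$. Put $$y_\rho=a+\frac1{2\rho-1}\sum_{(\mu,\nu)\in S}\varepsilon_{\mu,\nu}b_{\mu,\nu},\qquad y_\rho'=\alpha_ba+b_0+\frac1{2\rho-1}\sum_{(\mu,\nu)\in S}b_{\mu,\nu}.$$ (i) Suppose $\gamma_0=0$. Then $\alpha_y\neq0$ and $\gamma_{\mu,\nu}=\frac{\varepsilon_{\mu,\nu}}{2\rho-1}\alpha_y$ for all $(\mu,\nu)\in S^\circ$, i.e. $y=\alpha_yy_\rho$. Also $\theta_0=0$ and $\rho-\alpha_b=\frac2{2\rho-1}\theta_1$. Furthermore,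 if $S^\dagger\neq\emptyset$ then $\rho=\alpha_b$. Conversely, the following three conditions together imply that $y_\rho$ is a $(\rho,\rho)$-eigenvector of $b$: (1) $\theta_0=0$; (2) $\rho-\alpha_b=\frac2{2\rho-1}\theta_1$; (3) $\rho=\alpha_b$ when $A$ is not commutative. (ii) Assume $\gamma_0\neq0$ and normalize $\gamma_0=1$. Then $y=(\alpha_y-\alpha_b)y_\rho+y_\rho'$, implying $\dim A_{\rho,\rho}(b)\leq2$, and: (a) $\gamma_{\mu,\nu}=\frac{\varepsilon_{\mu,\nu}(\alpha_y-\alpha_b)+1}{2\rho-1}$ for $(\mu,\nu)\in S^\circ$ (E1); $0=\alpha_y\big(\alpha_b+\frac2{2\rho-1}\theta_1-\rho\big)+(\alpha_b-\alpha_b^2)-\frac{2\alpha_b}{2\rho-1}\theta_1+\frac{2(1-\rho)}{2\rho-1}\theta_1'$ (E2), or equivalently $2\theta_1(\alpha_y-\alpha_b)=(\alpha_y-\alpha_b)(\rho-\alpha_b)(2\rho-1)+\alpha_b(\rho-1)(2\rho-1)+2(\rho-1)\theta_1'$; $0=\frac{2\theta_0}{2\rho-1}\alpha_y+(1-\rho)-\frac{2\alpha_b\theta_0}{2\rho-1}+\frac{2(1-\rho)}{2\rho-1}\theta_0'$ (E3), or equivalently $2\theta_0(\alpha_y-\alpha_b)=(2\rho-1)(\rho-1)+2(\rho-1)\theta_0'$; and $(\rho-\alpha_b)\gamma_{\mu,\nu}=1-\alpha_b$ for all $(\mu,\nu)\in S^\dagger$ (E4). (b) For $\rho=1$, $y_\rho'=b\in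 A_1(b)$. For $\rho\neq1$, $y_\rho'\in A_{\rho,\rho}(b)$ if and only if $\theta_0'=\frac12-\rho$ and $\theta_1'=\alpha_b(\frac12-\rho)$, and $\alpha_b=\frac12$ when $A$ is not commutative. (c) If $y_\rho\notin A_{\rho,\rho}(b)$, then $y$ is determined as follows. If $\rho-\alpha_b\neq\frac2{2\rho-1}\theta_1$, then $\alpha_y$ is given by (E2) and the $\gamma_{\mu,\nu}$ by (E1). If $\theta_0\neq0$, then $\alpha_y$ is given by (E3) and the $\gamma_{\mu,\nu}$ by (E1). Finally, if both $\rho-\alpha_b=\frac2{2\rho-1}\theta_1$ and $\theta_0=0$, then $A$ is not commutative and $\rho\neq\alpha_b$, so $\gamma_{\mu,\nu}$ is given by (E4) for all $(\mu,\nu)\in S^\dagger$, and by (E1) either $\alpha_y=\alpha_b$ or $\alpha_y$ is given by (E1), and again all $\gamma_{\mu,\nu}$ are given by (E1). (iii) (a) $\dim A_{\rho,\rho}(b)=2$ if and only if $A_{\rho,\rho}(b)=\mathbb Fy_\rho+\mathbb Fy_\rho'$. (b) $A_{\rho,\rho}(b)=\mathbb Fy_\rho$ if and only if conditions (1), (2), (3) of (i) hold and $y_\rho'\notin A_{\rho,\rho}(b)$. (c) (1) If $A$ is not commutative, $\dim A_{\rho,\rho}(b)=2$ implies $\rho=\alpha_b=1$. (2) $A_1(b)=\mathbb Fb+\mathbb F\big(a+\sum_{(\mu,\nu)\in S}\varepsilon_{\mu,\nu}b_{\mu,\nu}\big)$ if and only if $\sum_{(\mu,\nu)\in S}\mu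 b_{\mu,\nu}^2=\frac{1-\alpha_b}2a$. (d) If $\rho\neq1$, then $\dim A_{\rho,\rho}(b)=2$ if and only if $\rho=\frac12-\theta_0'=\alpha_b+\frac2{2\rho-1}\theta_1$ and, in case $\alpha_b\neq0$, also $\rho=\frac12-\frac{\theta_1'}{\alpha_b}$. In particular $A$ is then commutative, and there is at most one $\rho\notin\{\frac12,1\}$ for which $\dim A_{\rho,\rho}(b)=2$. (e) If $\theta_0\neq0$, then there are at most three possible values of $\rho$ defining a $(\rho,\rho)$-eigenvector, and $\dim A_{\rho,\rho}(b)=1$. (f) If $\theta_0=0$ and $\rho\neq1$, then $\rho=\frac12-\theta_0'$; if moreover $\rho-\alpha_b\neq\frac2{2\rho-1}\theta_1$, then $\dim A_{\rho,\rho}(b)=1$.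
   Context: $\mathbb F$ is a field of characteristic $\ne 2$. Algebras are $\mathbb F$-algebras, not assumed associative, commutative or unital; $\langle\langle X\rangle\rangle$ is the subalgebra generated by $X$. For $y\in A$ put $L_y(z)=yz$, $R_y(z)=zy$; $A_\mu(L_y)$ and $A_\nu(R_y)$ denote eigenspaces. An axis of $A$ is an idempotent $a$ such that $A$ is the direct sum of the eigenspaces of $L_a$, $A$ is the direct sum of the eigenspaces of $R_a$, and $L_aR_a=R_aL_a$. Let $S_L(a),S_R(a)$ be the sets of eigenvalues of $L_a,R_a$; $A_{\mu,\nu}(a)=A_\mu(L_a)\cap A_\nu(R_a)$, whose nonzero elements are the $(\mu,\nu)$-eigenvectors of $a$; $A_\mu(a)=A_{\mu,\mu}(a)$; $S=S(a)=(S_L(a)\times S_R(a))\setminus\{(0,0),(1,1)\}$; $S^\circ(a)=\{(\mu,\nu)\in S(a):A_{\mu,\nu}(a)\neq0\}$; $S^\dagger(a)=\{(\mu,\nu)\in S^\circ(a):\mu\neq\nu\}$. So $A=A_1(a)\oplus A_0(a)\oplus\bigoplus_{(\mu,\nu)\in S}A_{\mu,\nu}(a)$, and each $y\in A$ is written accordingly as $y=y_1+y_0+\sum_{(\mu,\nu)\in S}y_{\mu,\nu}$. In particular $b=\alpha_ba+b_0+\sum b_{\mu,\nu}$. The axis $a$ is weakly primitive if $A_1(a)=\mathbb F a$; then $y_1=\alpha_ya$ with $\alpha_y\in\mathbb F$. The axis $a$ satisfies the fusion rules if: (a) $A_{\mu,\nu}(a)A_{\mu',\nu'}(a)=0$ for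 all $(\mu,\nu)\neq(\mu',\nu')$ in $S$; (b) $A_{\mu,\nu}(a)^2\subseteq A_0(a)+A_1(a)$ for $(\mu,\nu)\in S$; (c) $(A_0(a)+A_1(a))(A_0(a)+A_1(a))\subseteq A_0(a)+A_1(a)$; (d) $(A_1(a)+A_0(a))A_{\mu,\nu}(a)\subseteq A_{\mu,\nu}(a)$ and $A_{\mu,\nu}(a)(A_1(a)+A_0(a))\subseteq A_{\mu,\nu}(a)$ for $(\mu,\nu)\in S$. Under the hypotheses of the claim, $A=\mathbb Fa+\mathbb Fb_0+\sum_{(\mu,\nu)\in S^\circ(a)}\mathbb Fb_{\mu,\nu}$ and these spanning elements form a basis.
   Formalization: Part (iii) is corrected: in (d) the right-hand side also requires θ_0=0; in (e) the bound of three counts only ρ∉{1/2,1}; in (f) the first claim ρ=1/2−θ_0' is stated for eigenvectors y with γ_0≠0 (not needed when ρ−α_b≠2θ_1/(2ρ−1)). *)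

(* Defs.v *)
From mathcomp Require Export all_boot all_order all_algebra sesquilinear.
From mathcomp Require Export boolp classical_sets functions cardinality fsbigop.

Set Implicit Arguments.
Unset Strict Implicit.
Unset Printing Implicit Defensive.

Export GRing.Theory.
Open Scope classical_set_scope.
Open Scope ring_scope.

(* An algebra over F, not necessarily associative, commutative or unital, is a
   module A : lmodType F together with a product mul : {bilinear A -> A -> A}.
   No finiteness of the dimension is built in.  Subspaces are sets of vectors. *)

Definition lin_indep (F : fieldType) (A : lmodType F) (n : nat)
    (e : 'I_n -> A) : Prop :=
  forall c : 'I_n -> F, \sum_(i < n) c i *: e i = 0 -> forall i, c i = 0.

Definition dim_eq (F : fieldType) (A : lmodType F) (V : set A) (n : nat) : Prop :=
  exists e : 'I_n -> A,
    [/\ forall i, V (e i), lin_indep e &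
        forall x, V x -> exists c : 'I_n -> F, x = \sum_(i < n) c i *: e i].

Definition dim_le (F : fieldType) (A : lmodType F) (V : set A) (n : nat) : Prop :=
  exists2 m, (m <= n)%N & dim_eq V m.

(* Allows V to be infinite-dimensional. *)
Definition dim_ge (F : fieldType) (A : lmodType F) (V : set A) (n : nat) : Prop :=
  exists e : 'I_n -> A, (forall i, V (e i)) /\ lin_indep e.

Definition addsp (F : fieldType) (A : lmodType F) (U V : set A) : set A :=
  [set u + v | u in U & v in V].

Definition line (F : fieldType) (A : lmodType F) (u : A) : set A :=
  [set k *: u | k in [set: F]].

(* The sum over I is the finite-support sum of fsbigop, which is 0 when the
   support is infinite; hence the explicit finiteness condition. *)
Definition finsupp (F : fieldType) (A : lmodType F) (I : choiceType)
    (D : set I) (v : I -> A) : Prop :=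
  finite_set (D `&` [set i | v i != 0]).

Definition is_direct_sum (F : fieldType) (A : lmodType F) (I : choiceType)
    (D : set I) (V : I -> set A) : Prop :=
  (forall x : A, exists v : I -> A,
     [/\ forall i, D i -> V i (v i), finsupp D v & x = \sum_(i \in D) v i]) /\
  (forall v : I -> A, (forall i, D i -> V i (v i)) -> finsupp D v ->
     \sum_(i \in D) v i = 0 -> forall i, D i -> v i = 0).

Definition is_subalgebra (F : fieldType) (A : lmodType F)
    (mul : {bilinear A -> A -> A}) (B : set A) : Prop :=
  [/\ B 0, forall (k : F) u v, B u -> B v -> B (k *: u + v) &
      forall u v, B u -> B v -> B (mul u v)].

Definition gen_subalgebra (F : fieldType) (A : lmodType F)
    (mul : {bilinear A -> A -> A}) (X : set A) : set A :=
  [set x | forall B, is_subalgebra mul B -> X `<=` B -> B x].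

Definition commutative_alg (F : fieldType) (A : lmodType F)
    (mul : {bilinear A -> A -> A}) : Prop :=
  forall x y : A, mul x y = mul y x.

Definition eigL (F : fieldType) (A : lmodType F)
    (mul : {bilinear A -> A -> A}) (y : A) (mu : F) : set A :=
  [set z | mul y z = mu *: z].

Definition eigR (F : fieldType) (A : lmodType F)
    (mul : {bilinear A -> A -> A}) (y : A) (nu : F) : set A :=
  [set z | mul z y = nu *: z].

Definition SL (F : fieldType) (A : lmodType F)
    (mul : {bilinear A -> A -> A}) (y : A) : set F :=
  [set mu | exists2 z, z != 0 & eigL mul y mu z].

Definition SR (F : fieldType) (A : lmodType F)
    (mul : {bilinear A -> A -> A}) (y : A) : set F :=
  [set nu | exists2 z, z != 0 & eigR mul y nu z].

Definition is_axis (F : fieldType) (A : lmodType F)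
    (mul : {bilinear A -> A -> A}) (y : A) : Prop :=
  [/\ mul y y = y,
      is_direct_sum (SL mul y) (eigL mul y),
      is_direct_sum (SR mul y) (eigR mul y) &
      forall z, mul y (mul z y) = mul (mul y z) y].

(* A pair (mu, nu) of eigenvalues is encoded as p : F * F. *)
Definition eig2 (F : fieldType) (A : lmodType F)
    (mul : {bilinear A -> A -> A}) (y : A) (p : F * F) : set A :=
  eigL mul y p.1 `&` eigR mul y p.2.

Definition eig (F : fieldType) (A : lmodType F)
    (mul : {bilinear A -> A -> A}) (y : A) (mu : F) : set A :=
  eig2 mul y (mu, mu).

Definition is_eigvec (F : fieldType) (A : lmodType F)
    (mul : {bilinear A -> A -> A}) (y : A) (mu : F) (z : A) : Prop :=
  z != 0 /\ eig mul y mu z.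

Definition Saxis (F : fieldType) (A : lmodType F)
    (mul : {bilinear A -> A -> A}) (y : A) : set (F * F) :=
  (SL mul y `*` SR mul y) `\` [set (0, 0); (1, 1)].

Definition Scirc (F : fieldType) (A : lmodType F)
    (mul : {bilinear A -> A -> A}) (y : A) : set (F * F) :=
  [set p | Saxis mul y p /\ exists2 z, z != 0 & eig2 mul y p z].

Definition Sdag (F : fieldType) (A : lmodType F)
    (mul : {bilinear A -> A -> A}) (y : A) : set (F * F) :=
  [set p | Scirc mul y p /\ p.1 != p.2].

Definition weakly_primitive (F : fieldType) (A : lmodType F)
    (mul : {bilinear A -> A -> A}) (y : A) : Prop :=
  eig mul y 1 = line y.

Definition fusion_rules (F : fieldType) (A : lmodType F)
    (mul : {bilinear A -> A -> A}) (y : A) : Prop :=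
  let A01 := addsp (eig mul y 0) (eig mul y 1) in
  [/\ forall p q, Saxis mul y p -> Saxis mul y q -> p <> q ->
        forall u v, eig2 mul y p u -> eig2 mul y q v -> mul u v = 0,
      forall p, Saxis mul y p ->
        forall u v, eig2 mul y p u -> eig2 mul y p v -> A01 (mul u v),
      forall u v, A01 u -> A01 v -> A01 (mul u v) &
      forall p, Saxis mul y p -> forall u v, A01 u -> eig2 mul y p v ->
        eig2 mul y p (mul u v) /\ eig2 mul y p (mul v u)].

(* z = alpha a + z0 + sum_{(mu, nu) in S(a)} zc (mu, nu) is the decomposition
   of z with respect to the weakly primitive axis a.  The values of zc outside
   S(a) are irrelevant. *)
Definition decomposes (F : fieldType) (A : lmodType F)
    (mul : {bilinear A -> A -> A}) (a z : A)
    (alpha : F) (z0 : A) (zc : F * F -> A) : Prop :=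
  [/\ eig mul a 0 z0,
      forall p, Saxis mul a p -> eig2 mul a p (zc p),
      finsupp (Saxis mul a) zc &
      z = alpha *: a + z0 + \sum_(p \in Saxis mul a) zc p].

Definition eps (F : fieldType) (p : F * F) : F := p.1 + p.2.

Definition yvec (F : fieldType) (A : lmodType F)
    (mul : {bilinear A -> A -> A}) (a : A) (bc : F * F -> A) (rho : F) : A :=
  a + (2 * rho - 1)^-1 *: \sum_(p \in Saxis mul a) (eps p *: bc p).

Definition yvec' (F : fieldType) (A : lmodType F)
    (mul : {bilinear A -> A -> A}) (a : A) (alphab : F) (b0 : A)
    (bc : F * F -> A) (rho : F) : A :=
  alphab *: a + b0 + (2 * rho - 1)^-1 *: \sum_(p \in Saxis mul a) bc p.

(* Main.v *)
Require Import Defs.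
From mathcomp Require Import ring.

(* Put del p = mu - nu and t_p = b_0 b_p - b_p b_0.  Comparing components along
   a in b^2 = b and in b (z b) = (b z) b gives b_0 b_p + b_p b_0 =
   (1 - alpha_b eps_p) b_p, eps_p t_p = del p (2 alpha_b - 1 - alpha_b eps_p) b_p,
   and that every b_q^2 commutes with every b_p.

   These relations make A_p one-dimensional only when eps_p != 0: for eps_p = 0
   the vector b_0 b_p need not be a multiple of b_p.  Still,
   L_{b_0} + R_{b_0} - (1 - alpha_b eps_p) is locally nilpotent on the part of
   A_p generated by b_p, which is all of A_p; this forces the component in A_p
   of a (rho, rho)-eigenvector of b to be a multiple of b_p when rho != 1/2.
   Hence A_{rho, rho}(b) lies in the span of y_rho and y'_rho, and
   k y_rho + g y'_rho is an eigenvector iff three families of equations, linear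
   in (k, g), hold: two from b y + y b = 2 rho y in F a + F b_0, and one from
   b y = y b in each A_p.  All claims are read off from these, except that
   (iii)(d) with alpha_b = 0 also needs L_b + R_b to be diagonalizable. *)

Set Implicit Arguments.
Unset Strict Implicit.
Unset Printing Implicit Defensive.

(** * Normalization of linear combinations *)

(** Reified linear combinations: vectors become indices into a list of atoms, while scalars stay
    genuine elements of F, so that [ring] and [field] can settle the coefficient goals. *)
Inductive lcomb (F : Type) : Type :=
| LAtom of nat | LZero | LAdd of lcomb F & lcomb F | LOpp of lcomb F
| LScale of F & lcomb F.

Section LinearCombinations.
Variables (F : fieldType) (A : lmodType F).

Fixpoint leval (e : seq A) (t : lcomb F) : A :=
  match t with
  | LAtom i => nth 0 e i
  | LZero => 0
  | LAdd t1 t2 => leval e t1 + leval e t2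
  | LOpp t1 => - leval e t1
  | LScale k t1 => k *: leval e t1
  end.

Fixpoint lcoef (i : nat) (t : lcomb F) : F :=
  match t with
  | LAtom j => if eqn i j then 1 else 0
  | LZero => 0
  | LAdd t1 t2 => lcoef i t1 + lcoef i t2
  | LOpp t1 => - lcoef i t1
  | LScale k t1 => k * lcoef i t1
  end.

Fixpoint lcoef_eq (n : nat) (t1 t2 : lcomb F) : Prop :=
  if n is m.+1 then lcoef m t1 = lcoef m t2 /\ lcoef_eq m t1 t2 else True.

Lemma levalE e t : leval e t = \sum_(i < size e) lcoef i t *: nth 0 e i.
Proof.
elim: t => /= [j||t1 -> t2 ->|t1 ->|k t1 ->].
- have [ltj|gej] := ltnP j (size e).
    rewrite (bigD1 (Ordinal ltj)) //= [X in _ + X]big1 => [|i neij].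
      by rewrite (_ : eqn j j = true) ?scale1r ?addr0 //; apply/eqnP.
    rewrite (_ : eqn i j = false) ?scale0r //; apply/negP => /eqnP eij.
    by case/eqP: neij; apply: val_inj.
  rewrite nth_default // big1 // => i _.
  rewrite (_ : eqn i j = false) ?scale0r //; apply/negP => /eqnP eij.
  by have := ltn_ord i; rewrite eij ltnNge gej.
- by rewrite big1 // => i _; rewrite scale0r.
- by rewrite -big_split; apply: eq_bigr => i _; rewrite scalerDl.
- by rewrite -sumrN; apply: eq_bigr => i _; rewrite scaleNr.
- by rewrite scaler_sumr; apply: eq_bigr => i _; rewrite scalerA.
Qed.

Lemma leval_eq e t1 t2 : lcoef_eq (size e) t1 t2 -> leval e t1 = leval e t2.
Proof.
move=> H; rewrite !levalE; apply: eq_bigr => i _; congr (_ *: _).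
case: i => i /=; elim: (size e) H => // n IH /= [Hn H].
by rewrite ltnS leq_eqVlt => /predU1P[->|] //; apply: IH.
Qed.

End LinearCombinations.

(* Atoms are compared up to unification, since the same sum may occur with
   different canonical instances. *)
Ltac lmem x e :=
  lazymatch e with
  | nil => constr:(false)
  | cons ?y ?e' =>
    match constr:(Set) with
    | _ => let _ := match constr:(Set) with _ => unify x y end in constr:(true)
    | _ => lmem x e'
    end
  end.

Ltac latoms t e :=
  lazymatch t with
  | GRing.add ?x ?y => let e1 := latoms x e in latoms y e1
  | GRing.opp ?x => latoms x e
  | GRing.scale _ ?x => latoms x e
  | GRing.zero => e
  | ?x => lazymatch lmem x e with true => e | false => constr:(cons x e) end
  end.

Ltac lindex x e :=
  lazymatch e with
  | cons ?y ?e' =>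
    match constr:(Set) with
    | _ => let _ := match constr:(Set) with _ => unify x y end in constr:(0%N)
    | _ => let n := lindex x e' in constr:(S n)
    end
  end.

Ltac lquote F t e :=
  lazymatch t with
  | GRing.add ?x ?y =>
      let t1 := lquote F x e in let t2 := lquote F y e in constr:(@LAdd F t1 t2)
  | GRing.opp ?x => let t1 := lquote F x e in constr:(@LOpp F t1)
  | GRing.scale ?k ?x => let t1 := lquote F x e in constr:(@LScale F k t1)
  | GRing.zero => constr:(@LZero F)
  | ?x => let n := lindex x e in constr:(@LAtom F n)
  end.

(* Reduces an equality of linear combinations in a module over the field F to
   the equalities of the coefficients of each atom. *)
Ltac lmod F :=
  lazymatch goal with
  | |- @eq ?T ?x ?y =>
    let e0 := latoms x (@nil T) in
    let e := latoms y e0 in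
    let t1 := lquote F x e in
    let t2 := lquote F y e in
    apply: (@leval_eq F _ e t1 t2);
    cbn [lcoef_eq lcoef size eqn]; repeat split
  end.

(** Proof by certificate: a known relation l = r yields x = y once x - y is exhibited as a multiple
    of l - r, an identity left to [lmod]. *)
Lemma lin_from (F : fieldType) (A : lmodType F) (k : F) (l r x y : A) :
  l = r -> x - y = k *: (l - r) -> x = y.
Proof. by move=> ->; rewrite subrr scaler0 => /subr0_eq. Qed.

Lemma lin_from2 (F : fieldType) (A : lmodType F) (k k' : F) (l r l' r' x y : A) :
  l = r -> l' = r' -> x - y = k *: (l - r) + k' *: (l' - r') -> x = y.
Proof. by move=> -> ->; rewrite !subrr !scaler0 addr0 => /subr0_eq. Qed.

(** * Decomposition along the axis a *)

Section Bilinear.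
Variables (F : fieldType) (A : lmodType F) (mul : {bilinear A -> A -> A}).
Implicit Types (x y z : A) (k : F).

Lemma mul0v x : mul 0 x = 0. Proof. exact: linear0l. Qed.
Lemma mulv0 x : mul x 0 = 0. Proof. exact: linear0r. Qed.
Lemma mulvDl x y z : mul (x + y) z = mul x z + mul y z.
Proof. exact: linearDl. Qed.
Lemma mulvDr x y z : mul z (x + y) = mul z x + mul z y.
Proof. exact: linearDr. Qed.
Lemma mulvNl x y : mul (- x) y = - mul x y. Proof. exact: linearNl. Qed.
Lemma mulvNr x y : mul x (- y) = - mul x y. Proof. exact: linearNr. Qed.
Lemma mulvZl k x y : mul (k *: x) y = k *: mul x y.
Proof. exact: linearZl_LR. Qed.
Lemma mulvZr k x y : mul x (k *: y) = k *: mul x y.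
Proof. exact: linearZr_LR. Qed.
Lemma mulv_suml (I : Type) (s : seq I) (f : I -> A) x :
  mul (\sum_(i <- s) f i) x = \sum_(i <- s) mul (f i) x.
Proof. exact: linear_sumlz. Qed.
Lemma mulv_sumr (I : Type) (s : seq I) (f : I -> A) x :
  mul x (\sum_(i <- s) f i) = \sum_(i <- s) mul x (f i).
Proof. exact: linear_sumr. Qed.

Definition mulvE := (mulvDl, mulvDr, mulvNl, mulvNr, mulvZl, mulvZr).

Lemma eig2D a p x y : eig2 mul a p x -> eig2 mul a p y -> eig2 mul a p (x + y).
Proof.
rewrite /eig2 /eigL /eigR /= => -[xl xr] [yl yr].
by rewrite !mulvE xl xr yl yr !scalerDr.
Qed.

Lemma eig2Z a p k x : eig2 mul a p x -> eig2 mul a p (k *: x).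
Proof.
rewrite /eig2 /eigL /eigR /= => -[xl xr].
by rewrite !mulvE xl xr !scalerA ![k * _]mulrC.
Qed.

Lemma eig2_0 a p : eig2 mul a p 0.
Proof. by rewrite /eig2 /eigL /eigR /= mul0v mulv0 !scaler0. Qed.

Lemma eig2N a p x : eig2 mul a p x -> eig2 mul a p (- x).
Proof. by rewrite -scaleN1r; apply: eig2Z. Qed.

(** Applying L_a - mu_0 and R_a - nu_0 removes the term of p0 = (mu_0, nu_0). By induction (mu -
    mu_0) z_p and (nu - nu_0) z_p vanish, and one of the two factors is nonzero as p differs from
    p0. *)
Lemma eig2_indep a (s : seq (F * F)) (z : F * F -> A) :
  uniq s -> (forall p, p \in s -> eig2 mul a p (z p)) ->
  \sum_(p <- s) z p = 0 -> forall p, p \in s -> z p = 0.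
Proof.
elim: s z => [//|p0 s IH] z /= /andP[p0s us] zE.
rewrite big_cons => z0.
have zs p : p \in s -> eig2 mul a p (z p).
  by move=> ps; apply: zE; rewrite inE ps orbT.
have [zl zr] := zE p0 (mem_head _ _).
have kl : \sum_(p <- s) (p.1 - p0.1) *: z p = 0.
  have := congr1 (fun x => mul a x - p0.1 *: x) z0.
  rewrite mulv0 scaler0 subr0 mulvDr zl scalerDr opprD addrACA subrr add0r.
  rewrite mulv_sumr scaler_sumr -sumrB => E; rewrite -[RHS]E.
  by apply: eq_big_seq => p /zs[zpl _] /=; rewrite (zpl : _ = _) scalerBl.
have kr : \sum_(p <- s) (p.2 - p0.2) *: z p = 0.
  have := congr1 (fun x => mul x a - p0.2 *: x) z0.
  rewrite mul0v scaler0 subr0 mulvDl zr scalerDr opprD addrACA subrr add0r.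
  rewrite mulv_suml scaler_sumr -sumrB => E; rewrite -[RHS]E.
  by apply: eq_big_seq => p /zs[_ zpr] /=; rewrite (zpr : _ = _) scalerBl.
have zs0 p : p \in s -> z p = 0.
  move=> ps.
  have /eqP := IH _ us (fun q qs => eig2Z (q.1 - p0.1) (zs q qs)) kl _ ps.
  rewrite scaler_eq0 subr_eq0 => /orP[/eqP e1|/eqP //].
  have /eqP := IH _ us (fun q qs => eig2Z (q.2 - p0.2) (zs q qs)) kr _ ps.
  rewrite scaler_eq0 subr_eq0 => /orP[/eqP e2|/eqP //].
  by case/negP: p0s; rewrite [p0]surjective_pairing -e1 -e2 -surjective_pairing.
move=> p; rewrite inE => /predU1P[->|/zs0 //].
by rewrite big_seq big1 // addr0 in z0.
Qed.

End Bilinear.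

(** * Components in F a + F b_0 and in the joint eigenspaces A_p of a *)

Section Core.
Variables (F : fieldType) (A : lmodType F) (mul : {bilinear A -> A -> A}).
Variables (a b b0 : A) (beta : F) (Q : seq (F * F)) (v : F * F -> A).

Local Notation "x ** y" := (mul x y) (at level 40, left associativity).

(* v p stands for b_p, and Q lists the p in S(a) with b_p != 0. *)
Record axis_pair : Prop := AxisPair {
  two_neq0 : 2 != 0 :> F;
  uniqQ : uniq Q;
  Q_neq1 : (1, 1) \notin Q;
  Q_neq0 : (0, 0) \notin Q;
  a_neq0 : a != 0;
  b0_neq0 : b0 != 0;
  v_neq0 : forall p, p \in Q -> v p != 0;
  aa : a ** a = a;
  ab0 : a ** b0 = 0;
  b0a : b0 ** a = 0;
  v_eig : forall p, p \in Q -> eig2 mul a p (v p);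
  bE : b = beta *: a + b0 + \sum_(p <- Q) v p;
  bb : b ** b = b;
  b_flex : forall z, b ** (z ** b) = (b ** z) ** b;
  fus_neq : forall p q x y, p \in Q -> q \in Q -> p != q ->
    eig2 mul a p x -> eig2 mul a q y -> x ** y = 0;
  fus_sq : forall p x y, p \in Q -> eig2 mul a p x -> eig2 mul a p y ->
    exists c d, x ** y = c *: a + d *: b0;
  fus_b0 : exists c d, b0 ** b0 = c *: a + d *: b0;
  fus_b0l : forall p x, p \in Q -> eig2 mul a p x -> eig2 mul a p (b0 ** x);
  fus_b0r : forall p x, p \in Q -> eig2 mul a p x -> eig2 mul a p (x ** b0);
  generated : forall B, is_subalgebra mul B -> B a -> B b -> forall x, B x
}.

Hypothesis H : axis_pair.

(** In the application this is A_1(a) + A_0(a): there A_1(a) = F a and A_0(a) = F b_0. *)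
Definition A01 (u : A) := exists c d, u = c *: a + d *: b0.

Lemma A01_lin k u w : A01 u -> A01 w -> A01 (k *: u + w).
Proof.
move=> [c [d ->]] [c' [d' ->]]; exists (k * c + c'), (k * d + d').
lmod F; ring.
Qed.

Lemma A01_a : A01 a.
Proof. by exists 1, 0; rewrite scale1r scale0r addr0. Qed.

Lemma A01_b0 : A01 b0.
Proof. by exists 0, 1; rewrite scale1r scale0r add0r. Qed.

Lemma A01_0 : A01 0.
Proof. by exists 0, 0; rewrite !scale0r addr0. Qed.

Lemma A01D u w : A01 u -> A01 w -> A01 (u + w).
Proof. by move=> hu hw; rewrite -[u]scale1r; apply: A01_lin. Qed.

Lemma A01Z k u : A01 u -> A01 (k *: u).
Proof. by move=> hu; rewrite -[k *: u]addr0; apply: A01_lin => //; exact: A01_0. Qed.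

Lemma A01N u : A01 u -> A01 (- u).
Proof. by rewrite -scaleN1r; apply: A01Z. Qed.

Lemma A01_sum (f : F * F -> A) : (forall p, p \in Q -> A01 (f p)) ->
  A01 (\sum_(p <- Q) f p).
Proof.
move=> hf; rewrite big_seq; elim/big_rec: _ => [|p x /hf hp hx].
  exact: A01_0.
exact: A01D.
Qed.

Lemma A01_mul u w : A01 u -> A01 w -> A01 (u ** w).
Proof.
move=> [c [d ->]] [c' [d' ->]].
rewrite !mulvE (aa H) (ab0 H) (b0a H) !scaler0 addr0 add0r.
by apply: A01D; do !apply: A01Z; [exact: A01_a | exact: (fus_b0 H)].
Qed.

Lemma A01_eigl p u x : p \in Q -> A01 u -> eig2 mul a p x -> eig2 mul a p (u ** x).
Proof.
move=> pQ [c [d ->]] hx; rewrite !mulvE; apply: eig2D; apply: eig2Z.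
  by rewrite (hx.1 : _ = _); apply: eig2Z.
exact: (fus_b0l H).
Qed.

Lemma A01_eigr p u x : p \in Q -> A01 u -> eig2 mul a p x -> eig2 mul a p (x ** u).
Proof.
move=> pQ [c [d ->]] hx; rewrite !mulvE; apply: eig2D; apply: eig2Z.
  by rewrite (hx.2 : _ = _); apply: eig2Z.
exact: (fus_b0r H).
Qed.

Lemma comp0 u (z : F * F -> A) : A01 u ->
  (forall p, p \in Q -> eig2 mul a p (z p)) ->
  u + \sum_(p <- Q) z p = 0 -> u = 0 /\ forall p, p \in Q -> z p = 0.
Proof.
move=> [c [d uE]] hz.
(* The parts of u along a and b_0 are filed under the indices (1, 1) and (0, 0), which are not in Q,
   so that [eig2_indep] applies to the enlarged list. *)
pose w p := if p == (1, 1) then c *: a else if p == (0, 0) then d *: b0 else z p.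
have n10 : (1, 1) != (0, 0) :> F * F by rewrite xpair_eqE oner_eq0.
have wQ p : p \in Q -> w p = z p.
  rewrite /w => pQ; case: eqP => [p1|_].
    by move: (Q_neq1 H); rewrite -p1 pQ.
  by case: eqP => [p1|//]; move: (Q_neq0 H); rewrite -p1 pQ.
move=> uz.
have us : uniq [:: (1, 1), (0, 0) & Q].
  by rewrite /= inE negb_or n10 (Q_neq1 H) (Q_neq0 H) (uniqQ H).
have hw p : p \in [:: (1, 1), (0, 0) & Q] -> eig2 mul a p (w p).
  rewrite !inE => /or3P[/eqP->|/eqP->|pQ].
  - by rewrite /w eqxx; apply: eig2Z; split; rewrite /eigL /eigR /= scale1r (aa H).
  - rewrite /w eq_sym (negPf n10) eqxx; apply: eig2Z.
    by split; rewrite /eigL /eigR /= scale0r ?(ab0 H) ?(b0a H).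
  - by rewrite wQ //; apply: hz.
have w11 : w (1, 1) = c *: a by rewrite /w eqxx.
have w00 : w (0, 0) = d *: b0 by rewrite /w eq_sym (negPf n10) eqxx.
have /(eig2_indep us hw) w0 : \sum_(p <- [:: (1, 1), (0, 0) & Q]) w p = 0.
  by rewrite !big_cons w11 w00 addrA -uE -[RHS]uz; congr (_ + _); apply: eq_big_seq.
split=> [|p pQ]; last by rewrite -wQ // w0 // !inE pQ !orbT.
by rewrite uE -w11 -w00 !w0 ?addr0 // !inE eqxx ?orbT.
Qed.

Lemma comp_eq u u' (z z' : F * F -> A) : A01 u -> A01 u' ->
  (forall p, p \in Q -> eig2 mul a p (z p)) ->
  (forall p, p \in Q -> eig2 mul a p (z' p)) ->
  u + \sum_(p <- Q) z p = u' + \sum_(p <- Q) z' p ->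
  u = u' /\ forall p, p \in Q -> z p = z' p.
Proof.
move=> hu hu' hz hz' E.
have [|||uu zz] := @comp0 (u - u') (fun p => z p - z' p).
- by apply: A01D => //; apply: A01N.
- by move=> p pQ; apply: eig2D; [apply: hz | apply/eig2N/hz'].
- rewrite sumrB -[RHS](subrr (u' + \sum_(p <- Q) z' p)) -{1}E.
  by lmod F; ring.
split=> [|p pQ]; apply/subr0_eq; last exact: zz.
exact: uu.
Qed.

Lemma A01_inj c d c' d' : c *: a + d *: b0 = c' *: a + d' *: b0 -> c = c' /\ d = d'.
Proof.
move=> E; have : (c - c') *: a + (d - d') *: b0 = 0.
  by rewrite !scalerBl addrACA -opprD E subrr.
(* Left multiplication by a keeps the a-term and kills the b_0-term. *)
move/(congr1 (fun x => a ** x)); rewrite mulv0 !mulvE (aa H) (ab0 H) scaler0 addr0.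
move=> /eqP; rewrite scaler_eq0 (negPf (a_neq0 H)) orbF subr_eq0 => /eqP cc.
split=> //; apply/eqP; rewrite -subr_eq0 -[_ == 0]orbF -(negPf (b0_neq0 H)) -scaler_eq0.
by rewrite scalerBl subr_eq0; move: E; rewrite cc => /addrI->.
Qed.

(** Products of components with different indices vanish by the fusion rules. When u and u' are in
    [A01], the parenthesized part of the right side is in [A01] and the last sum collects the
    components in the A_p. *)
Lemma mul_comp u u' (z z' : F * F -> A) :
  (forall p, p \in Q -> eig2 mul a p (z p)) ->
  (forall p, p \in Q -> eig2 mul a p (z' p)) ->
  (u + \sum_(p <- Q) z p) ** (u' + \sum_(p <- Q) z' p) =
  (u ** u' + \sum_(p <- Q) z p ** z' p) + \sum_(p <- Q) (u ** z' p + z p ** u').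
Proof.
move=> hz hz'; rewrite !mulvE !mulv_sumr !mulv_suml big_split /=.
have -> : \sum_(q <- Q) (\sum_(p <- Q) z p) ** z' q = \sum_(p <- Q) z p ** z' p.
  apply: eq_big_seq => q qQ; rewrite mulv_suml (bigD1_seq q) //= ?(uniqQ H) //.
  rewrite big_seq_cond big1 ?addr0 // => p /andP[pQ pq].
  exact: (fus_neq H pQ qQ pq (hz p pQ) (hz' q qQ)).
lmod F; ring.
Qed.

End Core.

(** * Relations obtained from b b = b and b (x b) = (b x) b *)

Section Components.
Variables (F : fieldType) (A : lmodType F) (mul : {bilinear A -> A -> A}).
Variables (a b b0 : A) (beta : F) (Q : seq (F * F)) (v : F * F -> A).
Local Notation "x ** y" := (mul x y) (at level 40, left associativity).
Hypothesis H : axis_pair mul a b b0 beta Q v.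
Local Notation A01 := (A01 a b0).

Let b01 : A := beta *: a + b0.
Definition del (p : F * F) : F := p.1 - p.2.
Definition vcomm p : A := b0 ** v p - v p ** b0.

Let hv p (pQ : p \in Q) : eig2 mul a p (v p) := v_eig H pQ.
Let A01b : A01 b01.
Proof. by apply: A01_lin; [exact: A01_a | exact: A01_b0]. Qed.

Lemma idem_comp : b01 ** b01 + \sum_(p <- Q) v p ** v p = b01 /\
  forall p, p \in Q -> b01 ** v p + v p ** b01 = v p.
Proof.
have := bb H; rewrite {1 2 3}(bE H) (mul_comp H _ _ hv hv); apply: (comp_eq H) => //.
- apply: A01D; first exact: (A01_mul H).
  by apply: A01_sum => p pQ; apply: (fus_sq H pQ); exact: hv.
- by move=> p pQ; apply: eig2D; [apply: (A01_eigl H) | apply: (A01_eigr H)];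
     rewrite //; exact: hv.
Qed.

(** The A_p-component of b b = b, where a acts on v_p by scalars. It serves to trade v_p b_0 for b_0
    v_p. *)
Lemma v_b0 p : p \in Q ->
  v p ** b0 = (1 - beta * eps p) *: v p - b0 ** v p.
Proof.
move=> pQ; have := idem_comp.2 p pQ; have [vl vr] := hv pQ.
rewrite /b01 !mulvE (vl : _ = _) (vr : _ = _) => E.
apply: (lin_from (k := 1) E); rewrite /eps; lmod F; ring.
Qed.

Lemma b0_sq : b0 ** b0 + \sum_(p <- Q) v p ** v p =
  (beta - beta ^+ 2) *: a + b0.
Proof.
have := idem_comp.1; rewrite {1 2}/b01 !mulvE (aa H) (ab0 H) (b0a H) => E.
apply: (lin_from (k := 1) E); rewrite /b01; lmod F; ring.
Qed.

(** Components of b (x b) = (b x) b for x the sum of u and all z p. *)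
Lemma flex_comp u (z : F * F -> A) :
  A01 u -> (forall p, p \in Q -> eig2 mul a p (z p)) ->
  b01 ** (u ** b01 + \sum_(q <- Q) z q ** v q)
    + \sum_(p <- Q) v p ** (u ** v p + z p ** b01) =
  (b01 ** u + \sum_(q <- Q) v q ** z q) ** b01
    + \sum_(p <- Q) (b01 ** z p + v p ** u) ** v p /\
  forall p, p \in Q ->
    b01 ** (u ** v p + z p ** b01) + v p ** (u ** b01 + \sum_(q <- Q) z q ** v q) =
    (b01 ** u + \sum_(q <- Q) v q ** z q) ** v p + (b01 ** z p + v p ** u) ** b01.
Proof.
move=> hu hz.
have hL p : p \in Q -> eig2 mul a p (u ** v p + z p ** b01).
  move=> pQ; have [zp vp] := (hz p pQ, hv pQ).
  by apply: eig2D; [apply: (A01_eigl H) | apply: (A01_eigr H)].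
have hR p : p \in Q -> eig2 mul a p (b01 ** z p + v p ** u).
  move=> pQ; have [zp vp] := (hz p pQ, hv pQ).
  by apply: eig2D; [apply: (A01_eigl H) | apply: (A01_eigr H)].
have hl : A01 (u ** b01 + \sum_(q <- Q) z q ** v q).
  apply: A01D; first exact: (A01_mul H).
  by apply: A01_sum => p pQ; apply: (fus_sq H pQ); [exact: hz | exact: hv].
have hr : A01 (b01 ** u + \sum_(q <- Q) v q ** z q).
  apply: A01D; first exact: (A01_mul H).
  by apply: A01_sum => p pQ; apply: (fus_sq H pQ); [exact: hv | exact: hz].
have := b_flex H (u + \sum_(p <- Q) z p).
rewrite (bE H) -/b01 !(mul_comp H) //.
apply: (comp_eq H).
- apply: A01D; first exact: (A01_mul H).
  by apply: A01_sum => p pQ; apply: (fus_sq H pQ); [exact: hv | exact: hL].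
- apply: A01D; first exact: (A01_mul H).
  by apply: A01_sum => p pQ; apply: (fus_sq H pQ); [exact: hR | exact: hv].
- move=> p pQ; have [zp vp] := (hL p pQ, hv pQ).
  by apply: eig2D; [apply: (A01_eigl H) | apply: (A01_eigr H)].
- move=> p pQ; have [zp vp] := (hR p pQ, hv pQ).
  by apply: eig2D; [apply: (A01_eigl H) | apply: (A01_eigr H)].
Qed.

Let sum_single (z : A) q (f : F * F -> A) : q \in Q ->
  (forall r, r \in Q -> r != q -> f r = 0) -> \sum_(r <- Q) f r = f q.
Proof.
move=> qQ f0; rewrite (bigD1_seq q) ?(uniqQ H) //= big_seq_cond big1 ?addr0 //.
by move=> r /andP[rQ]; apply: f0.
Qed.

(** The case x = z of [flex_comp], with z in the single eigenspace A_q. *)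
Lemma flex_single q z : q \in Q -> eig2 mul a q z ->
  (b01 ** (z ** b01) + v q ** (z ** v q) = (v q ** z) ** v q + (b01 ** z) ** b01) /\
  forall p, p \in Q -> p != q -> v p ** (z ** v q) = (v q ** z) ** v p.
Proof.
move=> qQ hz; pose w r : A := if r == q then z else 0.
have hw r : r \in Q -> eig2 mul a r (w r).
  by rewrite /w; case: eqP => [->//|_ _]; exact: eig2_0.
have wq : w q = z by rewrite /w eqxx.
have w0 r : r != q -> w r = 0 by rewrite /w => /negPf->.
have [_ E] := flex_comp (A01_0 a b0) hw.
have sl : \sum_(r <- Q) w r ** v r = z ** v q.
  by rewrite (@sum_single 0 q) ?wq // => r _ /w0->; rewrite mul0v.
have sr : \sum_(r <- Q) v r ** w r = v q ** z.
  by rewrite (@sum_single 0 q) ?wq // => r _ /w0->; rewrite mulv0.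
split=> [|p pQ pq].
  by have := E q qQ; rewrite sl sr wq !mul0v !mulv0 !add0r addr0.
by have := E p pQ; rewrite sl sr w0 // !mul0v !mulv0 !add0r mulv0 !mul0v add0r addr0.
Qed.

(** The case x = a of [flex_comp]; both products of a with [b01] equal beta a. *)
Lemma flex_a : \sum_(p <- Q) del p *: (v p ** v p) = 0 /\
  forall p, p \in Q -> eps p *: vcomm p = (del p * (2 * beta - 1 - beta * eps p)) *: v p.
Proof.
have [E1 E2] := flex_comp (A01_a a b0) (z := fun=> 0) (fun p _ => eig2_0 mul a p).
have s1 : \sum_(q <- Q) 0 ** v q = 0 by rewrite big1 // => i _; rewrite mul0v.
have s2 : \sum_(q <- Q) v q ** 0 = 0 by rewrite big1 // => i _; rewrite mulv0.
have ab : a ** b01 = beta *: a.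
  by rewrite /b01 !mulvE (aa H) (ab0 H) addr0.
have ba : b01 ** a = beta *: a.
  by rewrite /b01 !mulvE (aa H) (b0a H) addr0.
split=> [|p pQ].
  move: E1; rewrite s1 s2 !addr0 ab ba !mulvZl !mulvZr ab ba => /addrI E.
  transitivity (\sum_(p <- Q) (v p ** (a ** v p + 0 ** b01) -
                               (b01 ** 0 + v p ** a) ** v p)).
    apply: eq_big_seq => p pQ; have [vl vr] := hv pQ.
    rewrite mul0v mulv0 addr0 add0r (vl : _ = _) (vr : _ = _) !mulvE.
    by rewrite /del scalerBl.
  by rewrite sumrB E subrr.
have := E2 p pQ; have [vl vr] := hv pQ.
rewrite s1 s2 !mul0v !mulv0 !addr0 !add0r ab ba (vl : _ = _) (vr : _ = _).
rewrite /b01 !mulvE (vl : _ = _) (vr : _ = _) (v_b0 pQ) => E.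
(* By [v_b0], [vcomm p] equals 2 b_0 v_p - (1 - beta eps p) v_p, whence the factor 2. *)
apply: (lin_from (k := 2) E); rewrite /vcomm (v_b0 pQ) /eps /del; lmod F; ring.
Qed.

(** If mu = nu, then eps p = 2 mu is nonzero, because p is not (0, 0) and 2 is invertible; [flex_a]
    then annihilates [vcomm p]. *)
Lemma vcomm_del0 p : p \in Q -> del p = 0 -> vcomm p = 0 /\ eps p != 0.
Proof.
move=> pQ dp; have ep : eps p != 0.
  apply: contra (Q_neq0 H); rewrite /eps (_ : p.1 = p.2); last exact/subr0_eq.
  rewrite -mulr2n -mulr_natl mulf_eq0 (negPf (two_neq0 H)) /= => /eqP p2.
  have p1 : p.1 = 0 by apply/subr0_eq; rewrite -[in RHS]dp /del p2.
  by rewrite -{1}p1 -p2 -surjective_pairing.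
split=> //; have /eqP := flex_a.2 p pQ.
by rewrite dp mul0r scale0r scaler_eq0 (negPf ep) => /eqP.
Qed.

(* Multiplying the relation of [flex_a] by v p handles the square of v p
   itself, on which flexibility says nothing. *)
Lemma v_sq_comm p q : p \in Q -> q \in Q ->
  v p ** (v q ** v q) = (v q ** v q) ** v p.
Proof.
move=> pQ qQ; have [->{q qQ}|pq] := eqVneq q p; last first.
  by apply: (flex_single qQ (hv qQ)).2; rewrite // eq_sym.
have [dp|dp] := eqVneq (del p) 0.
  have [c [d ->]] := fus_sq H pQ (hv pQ) (hv pQ).
  have [t0 _] := vcomm_del0 pQ dp.
  have [vl vr] := hv pQ.
  rewrite !mulvE (vl : _ = _) (vr : _ = _); congr (_ + _ *: _).
    by congr (_ *: (_ *: _)); apply/esym/subr0_eq.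
  by apply/esym/subr0_eq.
have := congr1 (fun x => v p ** x - x ** v p) flex_a.1.
rewrite mulv0 mul0v subrr mulv_sumr mulv_suml -sumrB (@sum_single 0 p) //.
  rewrite !mulvE -scalerBr => /eqP.
  by rewrite scaler_eq0 (negPf dp) /= subr_eq0 => /eqP.
move=> r rQ rp; rewrite !mulvE -scalerBr.
by rewrite (flex_single rQ (hv rQ)).2 ?subrr ?scaler0 // eq_sym.
Qed.

(** All squares v_q v_q commute with v_p, hence so does t1 a + t0 b_0; the left side is its
    commutator with v_p. *)
Lemma sq_sum_comm (c : F * F -> F) t1 t0 p : p \in Q ->
  \sum_(q <- Q) c q *: (v q ** v q) = t1 *: a + t0 *: b0 ->
  (t1 * del p) *: v p + t0 *: vcomm p = 0.
Proof.
move=> pQ E.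
have := congr1 (fun x => x ** v p - v p ** x) E.
have [vl vr] := hv pQ.
rewrite mulv_sumr mulv_suml -sumrB big_seq big1 => [|q qQ].
  rewrite !mulvE (vl : _ = _) (vr : _ = _) => E'.
  by apply: (lin_from (k := -1) E'); rewrite /vcomm /del; lmod F; ring.
by rewrite !mulvE (v_sq_comm pQ qQ) subrr.
Qed.

End Components.

(** * The elements of A_p generated by b_p, and nilpotency of the defect on them *)

Section Generation.
Variables (F : fieldType) (A : lmodType F) (mul : {bilinear A -> A -> A}).
Variables (a b b0 : A) (beta : F) (Q : seq (F * F)) (v : F * F -> A).
Local Notation "x ** y" := (mul x y) (at level 40, left associativity).
Hypothesis H : axis_pair mul a b b0 beta Q v.
Local Notation A01 := (A01 a b0).
Let hv p (pQ : p \in Q) : eig2 mul a p (v p) := v_eig H pQ.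

(** Measures how far z is from satisfying the relation [v_b0] of v_p. *)
Definition defect p (z : A) : A := b0 ** z + z ** b0 - (1 - beta * eps p) *: z.

Lemma defect_lin p k x y : defect p (k *: x + y) = k *: defect p x + defect p y.
Proof. by rewrite /defect !mulvE; lmod F; ring. Qed.

Lemma defect0 p : defect p 0 = 0.
Proof. by rewrite /defect mul0v mulv0 scaler0 !addr0 subr0. Qed.

Lemma iter_defect_lin p n k x y :
  iter n (defect p) (k *: x + y) = k *: iter n (defect p) x + iter n (defect p) y.
Proof. by elim: n => //= n ->; rewrite defect_lin. Qed.

Lemma iter_defect0 p n : iter n (defect p) 0 = 0.
Proof. by elim: n => //= n ->; exact: defect0. Qed.

Lemma defect_v p : p \in Q -> defect p (v p) = 0.
Proof. by move=> pQ; rewrite /defect (v_b0 H pQ); lmod F; ring. Qed.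

(** The part beta a of [b01] drops out of [flex_single], since L_a and R_a are scalars on A_p. *)
Lemma b0_mul_comm p z : p \in Q -> eig2 mul a p z ->
  b0 ** (z ** b0) - (b0 ** z) ** b0 = (v p ** z) ** v p - v p ** (z ** v p).
Proof.
move=> pQ hz; have [E _] := flex_single H pQ hz.
have [zl zr] := hz; have [rl _] := fus_b0r H pQ hz; have [_ lr] := fus_b0l H pQ hz.
move: E; rewrite !mulvE (zl : _ = _) (zr : _ = _) !mulvE (zl : _ = _) (zr : _ = _).
rewrite (rl : _ = _) (lr : _ = _) => E.
by apply: (lin_from (k := 1) E); lmod F; ring.
Qed.

(** For z = v_p the right side of [b0_mul_comm] vanishes by [v_sq_comm]; replacing v_p b_0 by [v_b0]
    turns the left side into minus the defect of b_0 v_p. *)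
Lemma defect_b0v p : p \in Q -> defect p (b0 ** v p) = 0.
Proof.
move=> pQ; have := b0_mul_comm pQ (hv pQ).
rewrite (v_sq_comm H pQ pQ) subrr (v_b0 H pQ) !mulvE => E.
by rewrite /defect; apply: (lin_from (k := -1) E); lmod F; ring.
Qed.

(** By [b0_mul_comm] and the fusion rules, the commutator of L_{b_0} and R_{b_0} maps A_p into the
    span of v_p and b_0 v_p, both killed by the defect. *)
Lemma defect_b0_mul_comm p z : p \in Q -> eig2 mul a p z ->
  defect p (b0 ** (z ** b0) - (b0 ** z) ** b0) = 0.
Proof.
move=> pQ hz; rewrite (b0_mul_comm pQ hz).
have [c [d ->]] := fus_sq H pQ (hv pQ) hz.
have [c' [d' ->]] := fus_sq H pQ hz (hv pQ).
have [vl vr] := hv pQ.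
rewrite !mulvE (vl : _ = _) (vr : _ = _) (v_b0 H pQ).
rewrite (_ : _ - _ = (d + d') *: (b0 ** v p) +
   ((c * p.1 - c' * p.2 - d' * (1 - beta * eps p)) *: v p + 0)); last first.
  by lmod F; ring.
by rewrite !defect_lin defect0 defect_v // defect_b0v // !scaler0 !addr0.
Qed.

Lemma defect_eig p z : p \in Q -> eig2 mul a p z -> eig2 mul a p (defect p z).
Proof.
move=> pQ hz; apply: eig2D; last exact/eig2N/eig2Z.
by apply: eig2D; [apply: (fus_b0l H) | apply: (fus_b0r H)].
Qed.

(** The defect commutes with L_{b_0} up to the commutator of R_{b_0} and L_{b_0}, which another
    defect kills. *)
Lemma defect2_b0 p z : p \in Q -> eig2 mul a p z ->
  defect p (defect p (b0 ** z)) = defect p (b0 ** defect p z).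
Proof.
move=> pQ hz; apply/subr0_eq.
rewrite -[RHS](scaler0 _ (-1)) -(defect_b0_mul_comm pQ hz) -scaleN1r addrC.
rewrite -defect_lin -[RHS]addr0 -[in RHS](defect0 p) -defect_lin; congr defect.
by rewrite /defect !mulvE; lmod F; ring.
Qed.

(** Multiplication by b_0 raises the nilpotency order by at most one: [defect2_b0] moves the defects
    past b_0 as long as one stays outside. *)
Lemma iter_defect_b0 p n z : p \in Q -> eig2 mul a p z ->
  iter n (defect p) z = 0 -> iter n.+1 (defect p) (b0 ** z) = 0.
Proof.
move=> pQ; elim: n z => [|n IH] z hz.
  by move=> /= ->; rewrite mulv0 defect0.
rewrite iterSr => /(IH _ (defect_eig pQ hz)).
by rewrite iterSr !iterSr => E; rewrite defect2_b0.
Qed.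

(* A_p is one-dimensional unless eps p = 0; in that case only the local
   nilpotency of [defect p] is available. *)
Definition good p z := [/\ eig2 mul a p z, exists n, iter n (defect p) z = 0 &
  del p = 0 -> exists k, z = k *: v p].

Lemma good_lin p k x y : good p x -> good p y -> good p (k *: x + y).
Proof.
move=> [hx [n nx] cx] [hy [m my] cy]; split.
- by apply: eig2D => //; apply: eig2Z.
- exists (n + m)%N; rewrite iter_defect_lin addnC iterD nx iter_defect0 scaler0.
  by rewrite addnC iterD my iter_defect0 addr0.
- move=> dp; have [c ->] := cx dp; have [d ->] := cy dp.
  by exists (k * c + d); lmod F; ring.
Qed.

Lemma good_v p : p \in Q -> good p (v p).
Proof.
move=> pQ; split; first exact: hv.
  by exists 1%N; rewrite /= defect_v.
by exists 1; rewrite scale1r.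
Qed.

Lemma good0 p : good p 0.
Proof.
split; [exact: eig2_0 | by exists 0%N | by exists 0; rewrite scale0r].
Qed.

Lemma b0v_del0 p : p \in Q -> del p = 0 ->
  b0 ** v p = (2^-1 * (1 - beta * eps p)) *: v p.
Proof.
move=> pQ dp; have [] := vcomm_del0 H pQ dp.
rewrite /vcomm (v_b0 H pQ) => E _.
by apply: (lin_from (k := 2^-1) E); lmod F; field; exact: two_neq0 H.
Qed.

Lemma good_b0l p z : p \in Q -> good p z -> good p (b0 ** z).
Proof.
move=> pQ [hz [n nz] cz]; split.
- exact: (fus_b0l H).
- by exists n.+1; apply: iter_defect_b0.
- move=> dp; have [k ->] := cz dp; rewrite mulvZr b0v_del0 // scalerA.
  by eexists.
Qed.

Lemma good_b0r p z : p \in Q -> good p z -> good p (z ** b0).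
Proof.
move=> pQ gz; have [hz [n nz] cz] := gz.
(* The definition of the defect expresses z b_0 through z, b_0 z and [defect p z]; the last is again
   nilpotent for the defect, and is 0 when del p = 0. *)
rewrite (_ : z ** b0 = (1 - beta * eps p) *: z + (-1 *: (b0 ** z) + defect p z)).
  apply: good_lin => //; apply: good_lin; first exact: good_b0l.
  split; [exact: defect_eig | by exists n; rewrite -iterSr /= nz defect0 |].
  move=> /cz[k ->]; exists 0.
  by rewrite -[k *: _]addr0 defect_lin defect_v // defect0 scaler0 scale0r addr0.
by rewrite /defect; lmod F; ring.
Qed.

Lemma good_A01l p u z : p \in Q -> A01 u -> good p z -> good p (u ** z).
Proof.
move=> pQ [c [d ->]] gz; have [zl _] := (let: And3 h _ _ := gz in h).
rewrite mulvDl !mulvZl (zl : _ = _) scalerA; apply: good_lin => //.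
by rewrite -[d *: _]addr0; apply: good_lin; [apply: good_b0l | apply: good0].
Qed.

Lemma good_A01r p u z : p \in Q -> A01 u -> good p z -> good p (z ** u).
Proof.
move=> pQ [c [d ->]] gz; have [_ zr] := (let: And3 h _ _ := gz in h).
rewrite mulvDr !mulvZr (zr : _ = _) scalerA; apply: good_lin => //.
by rewrite -[d *: _]addr0; apply: good_lin; [apply: good_b0r | apply: good0].
Qed.

(** The elements with such a decomposition form a subalgebra containing a and b, hence all of A. *)
Lemma good_decomposition x : exists u z,
  [/\ A01 u, forall p, p \in Q -> good p (z p) & x = u + \sum_(p <- Q) z p].
Proof.
pose B : set A := [set x | exists u z,
  [/\ A01 u, forall p, p \in Q -> good p (z p) & x = u + \sum_(p <- Q) z p]].
apply: (generated H (B := B)) x; first split.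
- exists 0, (fun=> 0); split; [exact: A01_0 | by move=> *; exact: good0 |].
  by rewrite big1 // addr0.
- move=> k _ _ [u [z [hu hz ->]]] [u' [z' [hu' hz' ->]]].
  exists (k *: u + u'), (fun p => k *: z p + z' p); split.
  + exact: A01_lin.
  + by move=> p pQ; apply: good_lin; [apply: hz | apply: hz'].
  + by rewrite big_split -scaler_sumr /=; lmod F; ring.
- move=> _ _ [u [z [hu hz ->]]] [u' [z' [hu' hz' ->]]].
  have ez p : p \in Q -> eig2 mul a p (z p) by case/hz.
  have ez' p : p \in Q -> eig2 mul a p (z' p) by case/hz'.
  rewrite (mul_comp H) //; do 2 eexists; split; last by [].
    apply: A01D; first exact: (A01_mul H).
    by apply: A01_sum => p pQ; apply: (fus_sq H pQ); [exact: ez | exact: ez'].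
  move=> p pQ /=; rewrite -[u ** _]scale1r; apply: good_lin.
    by apply: good_A01l => //; apply: hz'.
  by apply: good_A01r => //; apply: hz.
- exists a, (fun=> 0); split; [exact: A01_a | by move=> *; exact: good0 |].
  by rewrite big1 // addr0.
- exists (beta *: a + b0), v; split; last exact: bE H.
    by apply: A01_lin; [exact: A01_a | exact: A01_b0].
  by move=> p; apply: good_v.
Qed.

(** If p were outside Q, the decomposition of z minus z itself would be a relation between
    eigenvectors with distinct indices, so z = 0. This identifies Q with S°(a). *)
Lemma eigenspace_index p z : p != (1, 1) -> p != (0, 0) ->
  eig2 mul a p z -> z != 0 -> p \in Q.
Proof.
move=> p1 p0 hz; apply: contraR => pQ; apply/eqP.
have [_ [w [[c [d ->]] gw zE]]] := good_decomposition z.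
have n10 : (1, 1) != (0, 0) :> F * F by rewrite xpair_eqE oner_eq0.
pose f q := if q == p then - z else if q == (1, 1) then c *: a
            else if q == (0, 0) then d *: b0 else w q.
have fp : f p = - z by rewrite /f eqxx.
have f1 : f (1, 1) = c *: a by rewrite /f eq_sym (negPf p1) eqxx.
have f0 : f (0, 0) = d *: b0.
  by rewrite /f eq_sym (negPf p0) eq_sym (negPf n10) eqxx.
have fQ q : q \in Q -> f q = w q.
  rewrite /f => qQ; case: eqP => [qp|_]; first by rewrite -qp qQ in pQ.
  case: eqP => [q1|_]; first by move: (Q_neq1 H); rewrite -q1 qQ.
  by case: eqP => [q0|//]; move: (Q_neq0 H); rewrite -q0 qQ.
have us : uniq [:: p, (1, 1), (0, 0) & Q].
  by rewrite /= !inE !negb_or p1 p0 n10 pQ (Q_neq1 H) (Q_neq0 H) (uniqQ H).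
have hf q : q \in [:: p, (1, 1), (0, 0) & Q] -> eig2 mul a q (f q).
  rewrite !inE => /or4P[/eqP->|/eqP->|/eqP->|qQ].
  - by rewrite fp; apply: eig2N.
  - by rewrite f1; apply: eig2Z; split; rewrite /eigL /eigR /= scale1r (aa H).
  - rewrite f0; apply: eig2Z.
    by split; rewrite /eigL /eigR /= scale0r ?(ab0 H) ?(b0a H).
  - by rewrite fQ //; case: (gw q qQ).
have /(eig2_indep us hf) /(_ p (mem_head _ _)) :
    \sum_(q <- [:: p, (1, 1), (0, 0) & Q]) f q = 0.
  rewrite !big_cons fp f1 f0 (eq_big_seq w) // [X in - X + _]zE.
  by lmod F; ring.
by rewrite fp => /eqP; rewrite oppr_eq0 => /eqP.
Qed.

(** A nonzero v_p commutes with a only if del p = 0. Conversely, if all del p vanish, every good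
    component is a multiple of v_p, and v_p commutes with a and b_0. *)
Lemma commutative_del : commutative_alg mul <-> forall p, p \in Q -> del p = 0.
Proof.
split=> [com p pQ|d0 x y].
  have [vl vr] := hv pQ; have := com a (v p); rewrite (vl : _ = _) (vr : _ = _).
  move/eqP; rewrite -subr_eq0 -scalerBl scaler_eq0 (negPf (v_neq0 H pQ)) orbF.
  by move/eqP.
have [u [z [hu hz ->]]] := good_decomposition x.
have [u' [z' [hu' hz' ->]]] := good_decomposition y.
have ez p : p \in Q -> eig2 mul a p (z p) by case/hz.
have ez' p : p \in Q -> eig2 mul a p (z' p) by case/hz'.
have A01v w p k : A01 w -> p \in Q -> w ** (k *: v p) = (k *: v p) ** w.
  move=> [c [d ->]] pQ; have [vl vr] := hv pQ.
  rewrite !mulvE (vl : _ = _) (vr : _ = _).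
  rewrite (v_b0 H pQ) b0v_del0 ?d0 // (_ : p.1 = p.2); last first.
    exact/subr0_eq/d0.
  by lmod F; field; exact: two_neq0 H.
rewrite !(mul_comp H) //; congr (_ + _ + _).
- case: hu hu' => [c [d ->]] [c' [d' ->]].
  rewrite !mulvE (ab0 H) (b0a H); lmod F; ring.
- apply: eq_big_seq => p pQ.
  have [_ _ /(_ (d0 p pQ))[k ->]] := hz p pQ.
  have [_ _ /(_ (d0 p pQ))[k' ->]] := hz' p pQ.
  by rewrite !mulvE !scalerA mulrC.
- apply: eq_big_seq => p pQ.
  have [_ _ /(_ (d0 p pQ))[k ->]] := hz p pQ.
  have [_ _ /(_ (d0 p pQ))[k' ->]] := hz' p pQ.
  by rewrite A01v // [in RHS]addrC A01v.
Qed.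

End Generation.

(** * Eigenvectors of b *)

Section Eigenvectors.
Variables (F : fieldType) (A : lmodType F) (mul : {bilinear A -> A -> A}).
Variables (a b b0 : A) (beta : F) (Q : seq (F * F)) (v : F * F -> A).
Local Notation "x ** y" := (mul x y) (at level 40, left associativity).
Hypothesis H : axis_pair mul a b b0 beta Q v.
Let hv p (pQ : p \in Q) : eig2 mul a p (v p) := v_eig H pQ.
Local Notation t := (vcomm mul b0 v).

Variables (th1 th0 th1' th0' : F).
Hypothesis thE : \sum_(p <- Q) p.1 *: (v p ** v p) = th1 *: a + th0 *: b0.
Hypothesis th'E : \sum_(p <- Q) v p ** v p = th1' *: a + th0' *: b0.

(** Write eps p = 2 mu - del p; the sum weighted by del p vanishes by [flex_a]. *)
Lemma eps_sq_sum :
  \sum_(p <- Q) eps p *: (v p ** v p) = 2 *: (th1 *: a + th0 *: b0).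
Proof.
rewrite -thE.
transitivity (2 *: \sum_(p <- Q) p.1 *: (v p ** v p)
              - \sum_(p <- Q) del p *: (v p ** v p)).
  rewrite scaler_sumr -sumrB; apply: eq_bigr => p _.
  by rewrite /eps /del; lmod F; ring.
by rewrite (flex_a H).1 subr0.
Qed.

Lemma th_vcomm p : p \in Q -> (th1 * del p) *: v p + th0 *: t p = 0.
Proof. by move=> pQ; apply: (sq_sum_comm H pQ thE). Qed.

Lemma th'_vcomm p : p \in Q -> (th1' * del p) *: v p + th0' *: t p = 0.
Proof.
move=> pQ; apply: (sq_sum_comm H (c := fun=> 1) pQ).
by rewrite -th'E; apply: eq_bigr => q _; rewrite scale1r.
Qed.

Lemma th0_noncommutative p : p \in Q -> del p != 0 -> th0 = 0 -> th1 = 0.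
Proof.
move=> pQ dp E; have /eqP := th_vcomm pQ; rewrite E scale0r addr0 scaler_eq0.
by rewrite (negPf (v_neq0 H pQ)) orbF mulf_eq0 (negPf dp) orbF => /eqP.
Qed.

Variable rho : F.
Hypothesis rho_neq : 2 * rho - 1 != 0.
Let r := (2 * rho - 1)^-1.

(** The coefficient of b_p in an eigenvector with gamma_0 = g and alpha_y = k + g beta. *)
Definition gcoef (k g : F) (p : F * F) : F := (2 * rho - 1)^-1 * (eps p * k + g).

(* The vector k y_rho + g y'_rho of the paper. *)
Definition zvec (k g : F) : A :=
  ((k + g * beta) *: a + g *: b0) + \sum_(p <- Q) gcoef k g p *: v p.

(** For z = [zvec k g], [K1] and [K0] are half the coefficients of a and b_0 in b z + z b - 2 rho z,
    and [KD] is the A_p-component of b z - z b. *)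
Definition K1 (k g : F) : F :=
  k * (beta + 2 * (2 * rho - 1)^-1 * th1 - rho)
  + g * (1 - rho) * (beta + 2 * (2 * rho - 1)^-1 * th1').
Definition K0 (k g : F) : F :=
  2 * (2 * rho - 1)^-1 * k * th0
  + g * (1 - rho) * (1 + 2 * (2 * rho - 1)^-1 * th0').
Definition KD (k g : F) p : A :=
  (gcoef k g p * beta * del p - (k + g * beta) * del p) *: v p
  + (gcoef k g p - g) *: t p.

Lemma gcoef_sum (f : F * F -> A) k g :
  \sum_(p <- Q) gcoef k g p *: f p =
  (r * k) *: \sum_(p <- Q) eps p *: f p + (r * g) *: \sum_(p <- Q) f p.
Proof.
rewrite !scaler_sumr -big_split; apply: eq_bigr => p _ /=.
by rewrite /gcoef -/r; lmod F; ring.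
Qed.

Lemma zvecE k g : zvec k g =
  k *: (a + r *: \sum_(p <- Q) eps p *: v p)
  + g *: (beta *: a + b0 + r *: \sum_(p <- Q) v p).
Proof. by rewrite /zvec gcoef_sum; lmod F; ring. Qed.

Let hz k g p (pQ : p \in Q) : eig2 mul a p (gcoef k g p *: v p).
Proof. by apply: eig2Z; apply: hv. Qed.

(** The choice of [gcoef] makes all A_p-components of b z + z b - 2 rho z vanish, so only multiples
    of a and b_0 remain. *)
Lemma anticomm_zvec k g : b ** zvec k g + zvec k g ** b =
  (2 * rho) *: zvec k g + ((2 * K1 k g) *: a + (2 * K0 k g) *: b0).
Proof.
have b00 : b0 ** b0 = (beta - beta ^+ 2) *: a + b0 - (th1' *: a + th0' *: b0).
  by rewrite -th'E -(b0_sq H) addrK.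
have sq : \sum_(p <- Q) gcoef k g p *: (v p ** v p) =
    (r * k) *: (2 *: (th1 *: a + th0 *: b0)) + (r * g) *: (th1' *: a + th0' *: b0).
  by rewrite gcoef_sum eps_sq_sum th'E.
have E1 : b ** zvec k g + zvec k g ** b =
    2 *: ((beta *: a + b0) ** ((k + g * beta) *: a + g *: b0)
          + \sum_(p <- Q) gcoef k g p *: (v p ** v p))
    + \sum_(p <- Q) (2 * rho) *: (gcoef k g p *: v p).
  rewrite (bE H) !(mul_comp H) //; do ?exact: hz.
  have -> : \sum_(p <- Q) v p ** (gcoef k g p *: v p) =
            \sum_(p <- Q) gcoef k g p *: (v p ** v p).
    by apply: eq_bigr => p _; rewrite mulvZr.
  have -> : \sum_(p <- Q) (gcoef k g p *: v p) ** v p =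
            \sum_(p <- Q) gcoef k g p *: (v p ** v p).
    by apply: eq_bigr => p _; rewrite mulvZl.
  rewrite addrACA -big_split /=; congr (_ + _).
    by rewrite !mulvE (aa H) (ab0 H) (b0a H); lmod F; ring.
  apply: eq_big_seq => p pQ; have [vl vr] := hv pQ.
  rewrite !mulvE (vl : _ = _) (vr : _ = _) (v_b0 H pQ) /gcoef /eps.
  by lmod F; field.
rewrite E1 sq -scaler_sumr /zvec !mulvE (aa H) (ab0 H) (b0a H) b00 /K1 /K0 -/r.
lmod F; rewrite /r; field; exact: rho_neq.
Qed.

Lemma comm_zvec k g : b ** zvec k g - zvec k g ** b = \sum_(p <- Q) KD k g p.
Proof.
rewrite (bE H) !(mul_comp H) //; do ?exact: hz.
have -> : \sum_(p <- Q) v p ** (gcoef k g p *: v p) =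
          \sum_(p <- Q) (gcoef k g p *: v p) ** v p.
  by apply: eq_bigr => p _; rewrite mulvZr mulvZl.
rewrite opprD addrACA -sumrB /= -[RHS]add0r; congr (_ + _).
  by rewrite !mulvE (aa H) (ab0 H) (b0a H); lmod F; ring.
apply: eq_big_seq => p pQ; have [vl vr] := hv pQ.
rewrite !mulvE (vl : _ = _) (vr : _ = _) /KD /vcomm /del.
by lmod F; ring.
Qed.

Lemma KD_eig k g p : p \in Q -> eig2 mul a p (KD k g p).
Proof.
move=> pQ; have vp := hv pQ.
apply: eig2D; apply: eig2Z => //; rewrite /vcomm.
by apply: eig2D; [apply: (fus_b0l H) | apply/eig2N/(fus_b0r H)].
Qed.

(** As 2 is invertible, b z = z b = rho z is equivalent to b z + z b = 2 rho z together with b z = z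
    b. *)
Lemma eig_zvec k g : eig mul b rho (zvec k g) <->
  [/\ K1 k g = 0, K0 k g = 0 & forall p, p \in Q -> KD k g p = 0].
Proof.
split=> [[zl zr]|[k1 k0 kd]].
  have := anticomm_zvec k g; have := comm_zvec k g.
  rewrite (zl : _ = _) (zr : _ = _) /= subrr => /esym E1.
  have -> : rho *: zvec k g + rho *: zvec k g = (2 * rho) *: zvec k g + (0 *: a + 0 *: b0).
    by lmod F; ring.
  move=> /addrI /(A01_inj H) [/esym/eqP + /esym/eqP].
  rewrite !mulf_eq0 (negPf (two_neq0 H)) => /eqP-> /eqP->; split=> //.
  rewrite -[LHS]add0r in E1.
  by have [] := comp0 H (A01_0 a b0) (@KD_eig k g) E1.
have /eqP := comm_zvec k g; rewrite big_seq big1 // subr_eq0 => /eqP E.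
have := anticomm_zvec k g; rewrite k1 k0 !mulr0 !scale0r !addr0 E => E2.
have zr : zvec k g ** b = rho *: zvec k g.
  apply: (lin_from (k := 2^-1) E2); lmod F; field; exact: two_neq0 H.
by split; rewrite /eigL /eigR /= ?E.
Qed.

(** Let w be the A_p-component of y minus [gcoef] times v_p. The eigenvector equations give [defect]
    w = (2 rho - 1) w; since the defect is nilpotent on w and 2 rho - 1 is nonzero, w = 0. *)
Lemma eig_is_zvec y : eig mul b rho y -> exists k g, y = zvec k g.
Proof.
have [_ [z [[c [d ->]] gz ->]]] := good_decomposition H y.
set u := c *: a + d *: b0; move=> [yl yr].
have hu : A01 a b0 u by exists c, d.
have ez p : p \in Q -> eig2 mul a p (z p) by case/gz.
have hb : A01 a b0 (beta *: a + b0).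
  by apply: A01_lin; [exact: A01_a | exact: A01_b0].
(* The coefficient of a in [zvec k g] is k + g beta, so k = c - d beta. *)
exists (c - d * beta), d; rewrite /zvec; congr (_ + _).
  by rewrite /u; lmod F; ring.
apply: eq_big_seq => p pQ.
have split_rho : rho *: (u + \sum_(q <- Q) z q) =
    rho *: u + \sum_(q <- Q) rho *: z q by rewrite scalerDr scaler_sumr.
have el : (beta *: a + b0) ** z p + v p ** u = rho *: z p.
  move: yl; rewrite /eigL /= (bE H) (mul_comp H) //.
  rewrite split_rho => /(comp_eq H)[||||_ ->//].
  - apply: A01D; first exact: (A01_mul H).
    by apply: A01_sum => q qQ; apply: (fus_sq H qQ); [exact: hv | exact: ez].
  - exact: A01Z.
  - move=> q qQ; have [eq hq] := (ez q qQ, hv qQ).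
    by apply: eig2D; [apply: (A01_eigl H) | apply: (A01_eigr H)].
  - by move=> q qQ; apply/eig2Z/ez.
have er : u ** v p + z p ** (beta *: a + b0) = rho *: z p.
  move: yr; rewrite /eigR /= (bE H) (mul_comp H) //.
  rewrite split_rho => /(comp_eq H)[||||_ ->//].
  - apply: A01D; first exact: (A01_mul H).
    by apply: A01_sum => q qQ; apply: (fus_sq H qQ); [exact: ez | exact: hv].
  - exact: A01Z.
  - move=> q qQ; have [eq hq] := (ez q qQ, hv qQ).
    by apply: eig2D; [apply: (A01_eigl H) | apply: (A01_eigr H)].
  - by move=> q qQ; apply/eig2Z/ez.
set g := gcoef _ _ p; have [vl vr] := hv pQ; have [zl zr] := ez p pQ.
have Nw : defect mul b0 beta p (-g *: v p + z p) =
    (2 * rho - 1) *: (- g *: v p + z p).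
  rewrite defect_lin (defect_v H pQ) scaler0 add0r /defect /g /gcoef.
  move: el er; rewrite /u !mulvE (vl : _ = _) (vr : _ = _) (zl : _ = _) (zr : _ = _).
  rewrite (v_b0 H pQ) => el er.
  apply: (lin_from2 (k := 1) (k' := 1) el er); rewrite /eps.
  by lmod F; field; exact: rho_neq.
have [_ [n nz] _] := gz p pQ.
have iterNw m : iter m (defect mul b0 beta p) (- g *: v p + z p) =
    (2 * rho - 1) ^+ m *: (- g *: v p + z p).
  elim: m => [|m IH]; first by rewrite scale1r.
  rewrite iterS IH -[X in defect _ _ _ _ X]addr0 defect_lin (defect0 mul) Nw addr0.
  by rewrite scalerA -exprSr.
have [_ [m nv] _] := good_lin (- g) (good_v H pQ) (gz p pQ).
move: nv; rewrite iterNw => /eqP; rewrite scaler_eq0 expf_eq0 (negPf rho_neq) andbF /=.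
by rewrite addrC scaleNr subr_eq0 => /eqP.
Qed.

(** By [flex_a], [KD 1 0 p] is 2 (beta - rho) del p / (2 rho - 1) times v_p. *)
Lemma KD_10 : (forall p, p \in Q -> KD 1 0 p = 0) <->
  (forall p, p \in Q -> del p != 0 -> rho = beta).
Proof.
have E p : p \in Q -> KD 1 0 p = (2 * r * (beta - rho) * del p) *: v p.
  move=> pQ; apply: (lin_from (k := r) ((flex_a H).2 p pQ)).
  by rewrite /KD /gcoef /r /vcomm; lmod F; field; exact: rho_neq.
split=> h p pQ; last first.
  rewrite E //; have [->|/(h p pQ)->] := eqVneq (del p) 0.
    by rewrite mulr0 scale0r.
  by rewrite subrr mulr0 mul0r scale0r.
move=> dp; have /eqP := h p pQ; rewrite E // scaler_eq0 (negPf (v_neq0 H pQ)) orbF.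
rewrite !mulf_eq0 (negPf (two_neq0 H)) invr_eq0 (negPf rho_neq) (negPf dp) orbF /=.
by rewrite subr_eq0 => /eqP.
Qed.

(** Multiplying [KD k g p] = 0 by eps p lets [flex_a] eliminate [vcomm p]. *)
Lemma KD_E4 k g p : p \in Q -> del p != 0 -> KD k g p = 0 ->
  (rho - beta) * gcoef k g p = g * (1 - beta).
Proof.
move=> pQ dp kd.
have : (2 * del p * (g * (1 - beta) - (rho - beta) * gcoef k g p)) *: v p = 0.
  apply: (lin_from2 (k := eps p) (k' := - (gcoef k g p - g)) kd ((flex_a H).2 p pQ)).
  by rewrite /KD /gcoef; lmod F; field; exact: rho_neq.
move/eqP; rewrite scaler_eq0 (negPf (v_neq0 H pQ)) orbF.
by rewrite !mulf_eq0 (negPf (two_neq0 H)) (negPf dp) /= subr_eq0 => /eqP.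
Qed.

(** [flex_a] does not determine [vcomm p] when eps p = 0. Instead [th'_vcomm] does, because theta_0'
    = 1/2 - rho is nonzero. *)
Lemma KD_01 : rho != 1 -> th0' = 2^-1 - rho -> th1' = beta * (2^-1 - rho) ->
  (forall p, p \in Q -> del p != 0 -> beta = 2^-1) ->
  forall p, p \in Q -> KD 0 1 p = 0.
Proof.
move=> rho1 e0 e1 hb p pQ; have h2 := two_neq0 H.
have [dp|dp] := eqVneq (del p) 0.
  rewrite /KD dp !mulr0 subr0 scale0r add0r.
  by rewrite (vcomm_del0 H pQ dp).1 scaler0.
apply: (lin_from (k := (gcoef 0 1 p - 1) / th0') (th'_vcomm pQ)).
have h3 : 1 + - rho * 2 != 0 by rewrite mulNr -oppr_eq0 opprB mulrC.
by rewrite /KD /gcoef e0 e1 (hb p pQ dp); lmod F; field; rewrite h2 rho_neq h3.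
Qed.

End Eigenvectors.

(** * Subspaces of a plane and diagonalizable operators *)

Section Planes.
Variables (F : fieldType) (A : lmodType F) (e1 e2 : A) (V : set A).
Hypothesis indep : forall k g, k *: e1 + g *: e2 = 0 -> k = 0 /\ g = 0.
Hypothesis V0 : V 0.
Hypothesis V_lin : forall k x y, V x -> V y -> V (k *: x + y).
Hypothesis V_sub : forall x, V x -> exists k g, x = k *: e1 + g *: e2.

Let VZ k x : V x -> V (k *: x).
Proof. by move=> Vx; rewrite -[k *: x]addr0; apply: V_lin. Qed.

Lemma det_plane k g k' g' : k * g' != k' * g ->
  V (k *: e1 + g *: e2) -> V (k' *: e1 + g' *: e2) -> V e1 /\ V e2.
Proof.
rewrite -subr_eq0 => d Vx Vy.
(* Cramer's rule for the nonzero determinant k g' - k' g. *)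
have e1E : e1 = (g' / (k * g' - k' * g)) *: (k *: e1 + g *: e2)
              + (- g / (k * g' - k' * g)) *: (k' *: e1 + g' *: e2).
  by lmod F; field.
have e2E : e2 = (- k' / (k * g' - k' * g)) *: (k *: e1 + g *: e2)
              + (k / (k * g' - k' * g)) *: (k' *: e1 + g' *: e2).
  by lmod F; field.
by split; [rewrite e1E | rewrite e2E]; apply: V_lin => //; apply: VZ.
Qed.

Lemma plane_lin_indep x y : V x -> V y ->
  (forall c d, c *: x + d *: y = 0 -> c = 0 /\ d = 0) -> V e1 /\ V e2.
Proof.
move=> Vx Vy ind; have [k [g xE]] := V_sub Vx; have [k' [g' yE]] := V_sub Vy.
have [d|] := eqVneq (k * g') (k' * g); last first.
  by move=> d; apply: (det_plane d); rewrite -?xE -?yE.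
(* With zero determinant, g' x - g y and k' x - k y both vanish; independence then makes all four
   coordinates zero, so x = 0, a contradiction. *)
have [g'0 g0] : g' = 0 /\ - g = 0.
  apply: ind; rewrite xE yE.
  rewrite (_ : _ + _ = (k * g' - k' * g) *: e1); last by lmod F; ring.
  by rewrite d subrr scale0r.
have [k'0 k0] : k' = 0 /\ - k = 0.
  apply: ind; rewrite xE yE (_ : g = 0) ?g'0; last by apply/eqP; rewrite -oppr_eq0 g0.
  by lmod F; ring.
have [/eqP] : (1 : F) = 0 /\ (0 : F) = 0; last by rewrite oner_eq0.
apply: ind; rewrite scale0r scale1r addr0 xE.
have /eqP := k0; have /eqP := g0; rewrite !oppr_eq0 => /eqP-> /eqP->.
by rewrite !scale0r addr0.
Qed.

Lemma dim_eq2P : dim_eq V 2 <-> V e1 /\ V e2.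
Proof.
split=> [[e [Ve ie _]]|[Ve1 Ve2]].
  apply: (plane_lin_indep (Ve ord0) (Ve ord_max)) => c d cd.
  have := ie (fun i => if i == ord0 then c else d).
  rewrite big_ord_recl big_ord1 /=.
  rewrite (_ : lift ord0 ord0 = ord_max :> 'I_2); last exact: val_inj.
  by move=> /(_ cd) h; split; [exact: (h ord0) | exact: (h ord_max)].
exists (fun i => if i == ord0 then e1 else e2); split.
- by move=> i; case: ifP.
- move=> c; rewrite big_ord_recl big_ord1 /= => /indep[c0 c1] i.
  have [->//|i0] := eqVneq i ord0.
  by rewrite -c1; congr c; apply: val_inj; case: i i0 => [[|[|?]]].
- move=> x /V_sub[k [g ->]]; exists (fun i => if i == ord0 then k else g).
  by rewrite big_ord_recl big_ord1.
Qed.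

Lemma addsp_planeP : V = addsp (line e1) (line e2) <-> V e1 /\ V e2.
Proof.
split=> [->|[Ve1 Ve2]].
  split.
    exists e1; first by exists 1; rewrite ?scale1r.
    by exists 0; [exists 0; rewrite ?scale0r | rewrite addr0].
  exists 0; first by exists 0; rewrite ?scale0r.
  by exists e2; [exists 1; rewrite ?scale1r | rewrite add0r].
apply/seteqP; split=> [x /V_sub[k [g ->]]|_ [_ [k _ <-] [_ [g _ <-] <-]]].
  by exists (k *: e1); [exists k | exists (g *: e2); [exists g |]].
by apply: V_lin => //; apply: VZ.
Qed.

Lemma line_planeP : V = line e1 <-> V e1 /\ ~ V e2.
Proof.
split=> [->|[Ve1 Ve2]].
  split; first by exists 1; rewrite ?scale1r.
  case=> k _ ke; have [|_ /eqP] := @indep k (-1).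
    by rewrite ke scaleN1r subrr.
  by rewrite oppr_eq0 oner_eq0.
apply/seteqP; split=> [x Vx|_ [k _ <-]]; last exact: VZ.
have [k [g xE]] := V_sub Vx; have [g0|g0] := eqVneq g 0.
  by exists k => //; rewrite xE g0 scale0r addr0.
case: Ve2; suff [] : V e1 /\ V e2 by [].
apply: (@det_plane 1 0 k g); rewrite -?xE //.
  by rewrite mul1r mulr0.
by rewrite scale1r scale0r addr0.
Qed.

Lemma line_dim1 (x : A) : x != 0 -> V x ->
  (forall y, V y -> exists k, y = k *: x) -> dim_eq V 1.
Proof.
move=> x0 Vx Vl; exists (fun=> x); split=> // [c|y /Vl[k ->]].
  rewrite big_ord1 => /eqP; rewrite scaler_eq0 (negPf x0) orbF => /eqP c0 i.
  by rewrite -c0 ord1.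
by exists (fun=> k); rewrite big_ord1.
Qed.

Lemma plane_dim1 k g : g != 0 -> V (k *: e1 + g *: e2) -> ~ V e1 -> dim_eq V 1.
Proof.
move=> g0 Vx Ve1; apply: (@line_dim1 (k *: e1 + g *: e2)) => //.
  by apply/negP => /eqP/indep[_ /eqP]; apply/negP.
move=> y Vy; have [k' [g' yE]] := V_sub Vy; exists (g' / g).
have [d|d] := eqVneq (k * g') (k' * g); last first.
  by case: Ve1; case: (det_plane d Vx); rewrite -?yE.
have k'E : k' = k * g' / g by rewrite d mulfK.
by rewrite yE k'E; lmod F; field.
Qed.

Lemma plane_dim_le2 : dim_le V 2.
Proof.
have [[Ve1 Ve2]|nV] := pselect (V e1 /\ V e2); first by exists 2 => //; apply/dim_eq2P.
have [[x [Vx x0]]|nx] := pselect (exists x, V x /\ x != 0); last first.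
  exists 0%N => //; exists (fun=> 0); split=> // [c _ []//|x Vx].
  exists (fun=> 0); rewrite big_ord0; apply/eqP/negP => x0; apply: nx.
  by exists x; split=> //; apply/negP.
exists 1%N => //; apply: (@line_dim1 x) => // y Vy.
apply/not_existsP => nk; apply: nV; apply: (plane_lin_indep Vx Vy) => c d.
have [->|d0] := eqVneq d 0.
  rewrite scale0r addr0 => /eqP; rewrite scaler_eq0 (negPf x0) orbF.
  by move/eqP.
move=> cd; case: (nk (- c / d)); apply: (lin_from (k := d^-1) cd).
by lmod F; field.
Qed.

End Planes.

(** * Finitely supported sums, and semisimplicity inherited from direct summands *)

Section FiniteSums.
Variables (F : fieldType) (A : lmodType F) (I : choiceType).
Implicit Types (D : set I) (s : seq I).

Lemma fsum_seq D s (f : I -> A) : uniq s -> (forall i, i \in s -> D i) ->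
  (forall i, D i -> i \notin s -> f i = 0) ->
  \sum_(i \in D) f i = \sum_(i <- s) f i.
Proof.
move=> us sD f0; rewrite [RHS]fsbig_seq //; apply/esym.
by apply: (fsbig_widen [set` s] D f) => // i [Di /negP]; apply: f0.
Qed.

Lemma finsupp_seq D (w : I -> A) : finsupp D w ->
  exists2 s, uniq s & forall i, i \in s <-> D i /\ w i != 0.
Proof.
move=> /finite_seqP[s sE]; exists (undup s); first exact: undup_uniq.
move=> i; rewrite mem_undup; suff -> : (i \in s) = [set` s] i :> Prop by rewrite -sE.
by [].
Qed.

(** As f preserves every V i, uniqueness of decompositions splits f (f w) = 0 into the same equation
    for each component. *)
Lemma direct_sum_semisimple D (V : I -> set A) (f : A -> A) :
  is_direct_sum D V ->
  (forall k x y, f (k *: x + y) = k *: f x + f y) ->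
  (forall i x, D i -> V i x -> V i (f x)) ->
  (forall i x, D i -> V i x -> f (f x) = 0 -> f x = 0) ->
  forall w, f (f w) = 0 -> f w = 0.
Proof.
move=> [dec uni] f_lin fV ss w; have [w_ [Vw fin ->]] := dec w.
have f0 : f 0 = 0 by have := f_lin (-1) 0 0; rewrite scaler0 addr0 scaleN1r addNr.
have fsum (s : seq I) (g : I -> A) : f (\sum_(i <- s) g i) = \sum_(i <- s) f (g i).
  elim: s => [|i s IH]; first by rewrite !big_nil.
  by rewrite !big_cons -[g i]scale1r f_lin IH !scale1r.
have [s us sE] := finsupp_seq fin.
have sD i : i \in s -> D i by move=> /sE[].
have w0 i : D i -> i \notin s -> w_ i = 0.
  move=> Di; apply: contraNeq => wi.
  by have -> : i \in s by apply/sE.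
rewrite (fsum_seq us sD) // !fsum => ff0.
have ffw i : D i -> f (f (w_ i)) = 0.
  apply: (uni (fun i => f (f (w_ i)))) => [j Dj||].
  - by do 2!apply: (fV _ _ Dj); exact: Vw.
  - apply: sub_finite_set fin => j [Dj /= fj]; split=> //.
    by apply: contraNN fj => /eqP->; rewrite !f0.
  - by rewrite (fsum_seq us sD) // => j Dj /(w0 j Dj)->; rewrite !f0.
rewrite big_seq big1 // => i /sD Di.
by apply: (ss i) => //; [exact: Vw | exact: ffw].
Qed.

End FiniteSums.

Section AxisSemisimple.
Variables (F : fieldType) (A : lmodType F) (mul : {bilinear A -> A -> A}) (b : A).
Hypothesis axb : is_axis mul b.
Local Notation "x ** y" := (mul x y) (at level 40, left associativity).

Lemma axis_semisimpleR k w :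
  let f x := x ** b - k *: x in f (f w) = 0 -> f w = 0.
Proof.
move=> f; have [_ _ dsR _] := axb; apply: (direct_sum_semisimple dsR).
- by move=> c x y; rewrite /f !mulvE; lmod F; ring.
- by move=> i x _ hx; rewrite /eigR /= /f !mulvE (hx : _ = _) !mulvE (hx : _ = _); lmod F; ring.
- move=> i x _ hx.
  have fE c : f (c *: x) = (c * (i - k)) *: x.
    by rewrite /f !mulvE (hx : _ = _); lmod F; ring.
  have := fE 1; rewrite scale1r mul1r => ->; rewrite fE => /eqP.
  by rewrite scaler_eq0 mulf_eq0 orbb => /orP[/eqP->|/eqP->]; rewrite ?scale0r ?scaler0.
Qed.

(** R_b preserves the i-eigenspace of L_b because the two commute, and there the operator is R_b -
    (k - i), which [axis_semisimpleR] covers. *)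
Lemma axis_semisimple k w :
  let f x := b ** x + x ** b - k *: x in f (f w) = 0 -> f w = 0.
Proof.
move=> f; have [_ dsL _ bcomm] := axb; apply: (direct_sum_semisimple dsL).
- by move=> c x y; rewrite /f !mulvE; lmod F; ring.
- move=> i x _ hx; rewrite /eigL /= /f !mulvE (hx : _ = _) bcomm !mulvE (hx : _ = _) !mulvE.
  by lmod F; ring.
move=> i x _ hx.
have fE y : b ** y = i *: y -> f y = y ** b - (k - i) *: y.
  by move=> hy; rewrite /f hy; lmod F; ring.
have hfx : b ** f x = i *: f x.
  by rewrite /f !mulvE (hx : _ = _) bcomm !mulvE (hx : _ = _) !mulvE; lmod F; ring.
by rewrite (fE _ hfx) fE //; apply: axis_semisimpleR.
Qed.

End AxisSemisimple.

(* The number of eigenvalues in (iii)(e) is bounded by the degree of the cubic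
   obtained by eliminating alpha_y from (E2) and (E3). *)
Lemma cubic_roots (F : fieldType) (b t1 t0 t1' t0' : F) (rs : seq F) :
  2 != 0 :> F -> uniq rs ->
  (forall r, r \in rs -> (2 * r - 1 + 2 * t0') * (2 * t1 - (r - b) * (2 * r - 1)) =
     2 * t0 * (b * (2 * r - 1) + 2 * t1')) ->
  (size rs <= 3)%N.
Proof.
move=> h2 urs rsP.
pose P := Poly [:: (2 * t0' - 1) * (2 * t1 - b) + 2 * t0 * b - 4 * t0 * t1';
  2 * (2 * t1 - b) + (2 * t0' - 1) * (1 + 2 * b) - 4 * t0 * b;
  2 * (1 + 2 * b) - 2 * (2 * t0' - 1); - (2 * 2)].
(* The leading coefficient is -4, nonzero as 2 is invertible. *)
have P0 : P != 0.
  apply/eqP => /(congr1 (fun p : {poly F} => p`_3)) /eqP.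
  by rewrite coef_Poly coef0 /= oppr_eq0 mulf_eq0 (negPf h2).
rewrite -ltnS; apply: leq_trans (max_poly_roots P0 _ urs) (size_Poly _).
apply/allP => r /rsP/eqP; rewrite -subr_eq0 => E.
rewrite /root horner_Poly /=; move: E; congr (_ == 0); ring.
Qed.

(** * Criteria for y_rho and y'_rho to be eigenvectors of b *)

Section Conclusions.
Variables (F : fieldType) (A : lmodType F) (mul : {bilinear A -> A -> A}).
Variables (a b b0 : A) (beta : F) (Q : seq (F * F)) (v : F * F -> A).
Local Notation "x ** y" := (mul x y) (at level 40, left associativity).
Hypothesis H : axis_pair mul a b b0 beta Q v.

Variables (th1 th0 th1' th0' : F).
Hypothesis thE : \sum_(p <- Q) p.1 *: (v p ** v p) = th1 *: a + th0 *: b0.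
Hypothesis th'E : \sum_(p <- Q) v p ** v p = th1' *: a + th0' *: b0.

Lemma noncommutative_del : ~ commutative_alg mul <-> exists2 p, p \in Q & del p != 0.
Proof.
split=> [nc|[p pQ dp] /(commutative_del H) /(_ p pQ) /eqP]; last exact/negP.
apply/not_exists2P => h; apply/nc/(commutative_del H) => p pQ.
by case: (h p) => // /negP; rewrite negbK => /eqP.
Qed.

Variable rho : F.
Hypothesis rho_neq : 2 * rho - 1 != 0.
Local Notation zv := (zvec a b0 beta Q v rho).
Local Notation gc := (gcoef rho).
Local Notation resa := (K1 beta th1 th1' rho).
Local Notation resb0 := (K0 th0 th0' rho).
Local Notation rescomm := (KD mul b0 beta v rho).

Lemma zvec_lin k g : zv k g = k *: zv 1 0 + g *: zv 0 1.
Proof. by rewrite !zvecE; lmod F; ring. Qed.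

Lemma zvec_eig2 k g p : p \in Q -> eig2 mul a p (gc k g p *: v p).
Proof. by move=> pQ; apply: eig2Z; apply: (v_eig H). Qed.

Lemma zvec_inj0 k g : k *: zv 1 0 + g *: zv 0 1 = 0 -> k = 0 /\ g = 0.
Proof.
rewrite -zvec_lin /zvec => /(comp0 H _ (@zvec_eig2 k g))[|+ _].
  by do 2 eexists.
rewrite (_ : _ + _ = (k + g * beta) *: a + g *: b0) //.
have -> : (0 : A) = 0 *: a + 0 *: b0 by rewrite !scale0r addr0.
by move=> /(A01_inj H)[e ge]; move: e; rewrite ge mul0r addr0.
Qed.

(** Coefficients are compared with those of [zvec], where k = alpha_y - gamma_0 alpha_b; the
    comparison is legitimate because each v_p is nonzero. *)
Lemma eigenvector_coef y al g (gam : F * F -> F) :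
  y = al *: a + g *: b0 + \sum_(p <- Q) gam p *: v p -> eig mul b rho y ->
  [/\ y = zv (al - g * beta) g,
      forall p, p \in Q -> gam p = gc (al - g * beta) g p,
      resa (al - g * beta) g = 0, resb0 (al - g * beta) g = 0 &
      forall p, p \in Q -> rescomm (al - g * beta) g p = 0].
Proof.
move=> yE hy; have [k' [g' yz]] := eig_is_zvec H rho_neq hy.
have [|||||/(A01_inj H)[alE ggE] gamE] := comp_eq H
    (u := al *: a + g *: b0) (u' := (k' + g' * beta) *: a + g' *: b0)
    (z := fun p => gam p *: v p) (z' := fun p => gc k' g' p *: v p).
- by do 2 eexists.
- by do 2 eexists.
- by move=> p pQ; apply: eig2Z; apply: (v_eig H).
- exact: zvec_eig2.
- by rewrite -yE yz.
have kE : al - g * beta = k' by rewrite alE ggE addrK.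
rewrite kE ggE; have [k1 k0 kd] := (eig_zvec H thE th'E rho_neq k' g').1 (ltac:(by rewrite -yz)).
split=> // p pQ; have /eqP := gamE p pQ.
by rewrite -subr_eq0 -scalerBl scaler_eq0 (negPf (v_neq0 H pQ)) orbF subr_eq0 => /eqP.
Qed.

Lemma noncommutative_th : ~ commutative_alg mul -> th0 = 0 -> th1 = 0.
Proof. by move=> /noncommutative_del[p pQ dp]; apply: (th0_noncommutative H thE pQ). Qed.

(** Eliminating [vcomm p] between [th'_vcomm] and [flex_a] leaves theta_0' (2 beta - 1) del p v_p =
    0. *)
Lemma noncommutative_th' : ~ commutative_alg mul ->
  th1' = beta * th0' -> th0' != 0 -> beta = 2^-1.
Proof.
move=> /noncommutative_del[p pQ dp] e1 e0; have h2 := two_neq0 H.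
have : (th0' * (2 * beta - 1) * del p) *: v p = 0.
  apply: (lin_from2 (k := eps p) (k' := - th0') (th'_vcomm H th'E pQ) ((flex_a H).2 p pQ)).
  by rewrite e1; lmod F; ring.
move/eqP; rewrite scaler_eq0 (negPf (v_neq0 H pQ)) orbF !mulf_eq0.
rewrite (negPf e0) (negPf dp) orbF /= subr_eq0 => /eqP hb.
by apply: (mulfI h2); rewrite hb divff.
Qed.

(** Without commutativity theta_0 = 0 forces theta_1 = 0, and the second equation then reads rho =
    beta. *)
Lemma cond12_cond3 : th0 = 0 -> rho - beta = 2 / (2 * rho - 1) * th1 ->
  ~ commutative_alg mul -> rho = beta.
Proof.
move=> e0 e1 /noncommutative_th/(_ e0) e; apply/eqP.
by rewrite -subr_eq0 e1 e mulr0.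
Qed.

Lemma eig_zvec10 : eig mul b rho (zv 1 0) <->
  th0 = 0 /\ rho - beta = 2 / (2 * rho - 1) * th1.
Proof.
rewrite (eig_zvec H thE th'E rho_neq) /K1 /K0.
rewrite !mul1r !mul0r !addr0 !mulr1; split.
  move=> [k1 /eqP k0 _]; split; last first.
    by apply/eqP; rewrite -subr_eq0 -oppr_eq0 -[X in _ == X]k1; apply/eqP; ring.
  move: k0; rewrite !mulf_eq0 (negPf (two_neq0 H)) invr_eq0 (negPf rho_neq) /=.
  by move/eqP.
move=> [e0 e1]; split; first by rewrite addrAC -[_ - rho]opprB e1 addrC subrr.
  by rewrite e0 mulr0.
apply/(KD_10 H rho_neq) => p pQ dp; apply: cond12_cond3 => //.
by apply/noncommutative_del; exists p.
Qed.

Lemma eig_zvec01 : rho != 1 -> eig mul b rho (zv 0 1) <->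
  [/\ th0' = 2^-1 - rho, th1' = beta * (2^-1 - rho) &
      ~ commutative_alg mul -> beta = 2^-1].
Proof.
move=> rho1; have h2 := two_neq0 H; have h1 : 1 - rho != 0 by rewrite subr_eq0 eq_sym.
rewrite (eig_zvec H thE th'E rho_neq) /K1 /K0 !mul0r !mulr0 !add0r !mul1r.
split=> [[/eqP k1 /eqP k0 kd]|[e0 e1 nc]].
  move: k1 k0; rewrite mul0r add0r !mulf_eq0 (negPf h1) /= => /eqP k1 /eqP k0.
  split.
  - have := congr1 (fun x => x * ((2 * rho - 1) / 2)) k0; rewrite mul0r => k0'.
    by apply/eqP; rewrite -subr_eq0 -k0'; apply/eqP; field; rewrite h2 rho_neq.
  - have := congr1 (fun x => x * ((2 * rho - 1) / 2)) k1; rewrite mul0r => k1'.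
    by apply/eqP; rewrite -subr_eq0 -k1'; apply/eqP; field; rewrite h2 rho_neq.
  - move=> /noncommutative_del[p pQ dp].
    have := KD_E4 H rho_neq pQ dp (kd p pQ); rewrite /gcoef mulr0 add0r mulr1 mul1r.
    (* [E] says (rho - beta) / (2 rho - 1) = 1 - beta; clearing the denominator and factoring gives
       this product. *)
    move=> E; have : (1 - rho) * (1 - 2 * beta) = 0.
      rewrite -[RHS](mulr0 (2 * rho - 1)) -[X in _ = _ * X](subrr (1 - beta)) -{1}E.
      by field.
    move/eqP; rewrite mulf_eq0 (negPf h1) /= subr_eq0 eq_sym => /eqP hb.
    by apply: (mulfI h2); rewrite hb divff.
split.
- by rewrite e1; field; rewrite rho_neq h2.
- by rewrite e0; field; rewrite rho_neq h2.
- apply: (KD_01 H th'E rho_neq rho1 e0 e1) => p pQ dp; apply: nc.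
  by apply/noncommutative_del; exists p.
Qed.

Lemma zvec10_neq0 : zv 1 0 != 0.
Proof.
apply/negP => /eqP h; have [] := @zvec_inj0 1 0.
  by rewrite h scaler0 scale0r addr0.
by move/eqP; rewrite oner_eq0.
Qed.

(* Were th1' nonzero, y'_rho would generate a nontrivial Jordan block of
   L_b + R_b, which is diagonalizable. *)
Lemma th1'_beta0 : is_axis mul b -> rho != 1 -> beta = 0 -> th0 = 0 ->
  rho - beta = 2 / (2 * rho - 1) * th1 -> th0' = 2^-1 - rho -> th1' = 0.
Proof.
move=> axb rho1 hb e0 e1 e0'; have h2 := two_neq0 H.
pose f x := b ** x + x ** b - (2 * rho) *: x.
have ss w : f (f w) = 0 -> f w = 0 := @axis_semisimple _ _ _ _ axb (2 * rho) w.
have f_lin k x y : f (k *: x + y) = k *: f x + f y.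
  by rewrite /f !mulvE; lmod F; ring.
have fZ k x : f (k *: x) = k *: f x.
  by rewrite /f !mulvE; lmod F; ring.
have fz k g : f (zv k g) = (2 * resa k g) *: a + (2 * resb0 k g) *: b0.
  by rewrite /f (anticomm_zvec H thE th'E rho_neq) addrC addKr.
have fY1 : f (zv 1 0) = 0.
  have /eig_zvec10/(eig_zvec H thE th'E rho_neq)[k1 k0 _] := conj e0 e1.
  by rewrite fz k1 k0 !mulr0 !scale0r addr0.
have [kap kapE] : exists k, k = 2 * ((1 - rho) * (2 * (2 * rho - 1)^-1 * th1')).
  by eexists.
have fY2 : f (zv 0 1) = kap *: a.
  rewrite fz /K1 /K0 hb e0 e0' kapE; lmod F; last by field; rewrite rho_neq h2.
  by field; rewrite rho_neq.
have fa : f a = (1 - 4 * rho) *: a + (2 * rho - 1) *: zv 1 0.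
  have hb0 : b = b0 + \sum_(p <- Q) v p by rewrite {1}(bE H) hb scale0r add0r.
  have ba : b ** a + a ** b = \sum_(p <- Q) eps p *: v p.
    rewrite hb0 !mulvE (b0a H) (ab0 H) !add0r mulv_suml mulv_sumr -big_split.
    apply: eq_big_seq => p pQ /=; have [vl vr] := v_eig H pQ.
    by rewrite (vl : _ = _) (vr : _ = _) /eps addrC scalerDl.
  by rewrite /f ba zvecE; lmod F; field; rewrite rho_neq.
have kap0 : kap = 0.
  (* If 1 - 4 rho = 0, then f a is a nonzero multiple of y_rho, which f kills; this contradicts
     [ss]. *)
  have [h|h] := eqVneq (1 - 4 * rho) 0.
    have /eqP : f a = 0.
      by apply: ss; rewrite fa h scale0r add0r fZ fY1 scaler0.
    by rewrite fa h scale0r add0r scaler_eq0 (negPf rho_neq) (negPf zvec10_neq0).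
  (* The multiple of a is chosen to cancel kap a in f y'_rho, leaving a multiple of y_rho, again
     killed by f. *)
  have E : f (- (kap / (1 - 4 * rho)) *: a + zv 0 1) =
      - (kap * (2 * rho - 1) / (1 - 4 * rho)) *: zv 1 0.
    by rewrite f_lin fa fY2; lmod F; field.
  have /eqP : f (- (kap / (1 - 4 * rho)) *: a + zv 0 1) = 0.
    by apply: ss; rewrite E fZ fY1 scaler0.
  rewrite E scaler_eq0 (negPf zvec10_neq0) orbF oppr_eq0 !mulf_eq0 invr_eq0.
  by rewrite (negPf rho_neq) (negPf h) !orbF => /eqP.
have /eqP := kap0; rewrite kapE !mulf_eq0 (negPf h2) invr_eq0 (negPf rho_neq) /=.
by rewrite subr_eq0 eq_sym (negPf rho1) /= => /eqP.
Qed.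

End Conclusions.

(** * Passage from the axioms on a and b to the finite data of [axis_pair] *)

Lemma axis_neq0 (F : fieldType) (A : lmodType F) (mul : {bilinear A -> A -> A}) (a : A) :
  dim_ge [set: A] 3 -> dim_eq (eig mul a 0) 1 -> a != 0.
Proof.
move=> [e [_ ie]] [f [_ _ fE]]; apply/negP => /eqP a0.
(* If a = 0, then A_0(a) is all of A, so A would be a line. *)
have gE x : exists c, x = c *: f ord0.
  have [|c ->] := fE x; first by rewrite a0; split; rewrite /eigL /eigR /= ?mul0v ?mulv0 scale0r.
  by exists (c ord0); rewrite big_ord1.
pose i1 : 'I_3 := lift ord0 ord0.
have [c0 e0] := gE (e ord0); have [c1 e1] := gE (e i1).
have n01 : i1 != ord0 by [].
have : c0 = 0.
  apply/eqP; rewrite -oppr_eq0; apply/eqP.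
  have := ie (fun i => if i == ord0 then c1 else if i == i1 then - c0 else 0) _ i1.
  rewrite (negPf n01) eqxx; apply.
  rewrite !big_ord_recl big_ord0 /= -/i1 e0 e1 scale0r !addr0.
  by rewrite !scalerA mulNr scaleNr mulrC subrr.
move=> c00; have /eqP : (1 : F) = 0; last by rewrite oner_eq0.
have := ie (fun i => if i == ord0 then 1 else 0) _ ord0; rewrite eqxx; apply.
by rewrite !big_ord_recl big_ord0 /= e0 c00 !scale0r scaler0 !addr0.
Qed.

(** Q lists the support of the decomposition of b; that it is all of S°(a) is [eigenspace_index],
    which rests on a and b generating A. *)
Lemma axis_pair_exists (F : fieldType) (A : lmodType F)
  (mul : {bilinear A -> A -> A}) (a b : A)
  (alphab : F) (b0 : A) (bc : F * F -> A) :
  2%N \notin [pchar F] -> gen_subalgebra mul [set a; b] = [set: A] ->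
  dim_ge [set: A] 3 -> is_axis mul a -> weakly_primitive mul a ->
  fusion_rules mul a -> dim_eq (eig mul a 0) 1 -> is_axis mul b ->
  decomposes mul a b alphab b0 bc -> b0 != 0 ->
  exists Q, [/\ axis_pair mul a b b0 alphab Q bc,
    forall p, p \in Q -> Saxis mul a p,
    forall p, Saxis mul a p -> p \notin Q -> bc p = 0 &
    forall p, Scirc mul a p <-> p \in Q].
Proof.
move=> charF genA dimA axa wpa fra dim0 axb decb b0n0.
have [aa _ _ _] := axa; have [bb _ _ b_flex] := axb.
have [b0E bcE fin bE] := decb; have [fneq fsq f01 fact] := fra.
have [Q uQ QE] := finsupp_seq fin.
have QS p : p \in Q -> Saxis mul a p by move=> /QE[].
have Q0 p : Saxis mul a p -> p \notin Q -> bc p = 0.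
  by move=> Sp; apply: contraNeq => h; have -> : p \in Q by apply/QE.
have [f [_ _ fE]] := dim0.
have b0_line x : eig mul a 0 x -> exists d, x = d *: b0.
  move=> /fE[c ->]; have [d b0d] := fE _ b0E; move: b0d; rewrite !big_ord1 => b0d.
  have d0 : d ord0 != 0.
    by apply: contraNneq b0n0 => d0; rewrite b0d d0 scale0r.
  by exists (c ord0 / d ord0); rewrite b0d scalerA mulfVK.
have A01E u : addsp (eig mul a 0) (eig mul a 1) u -> exists c d, u = c *: a + d *: b0.
  rewrite wpa => -[x /b0_line[d ->]] [_ [c _ <-] <-].
  by exists c, d; rewrite addrC.
have A01b0 : addsp (eig mul a 0) (eig mul a 1) b0.
  by exists b0 => //; exists 0; [exact: eig2_0 | rewrite addr0].
have [ab0 b0a] := b0E; rewrite /eigL /eigR /= !scale0r in ab0 b0a.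
have H : axis_pair mul a b b0 alphab Q bc.
  split=> //.
  - by apply/negP => /QS[_]; apply; right.
  - by apply/negP => /QS[_]; apply; left.
  - exact: (axis_neq0 dimA dim0).
  - by move=> p /QE[].
  - by move=> p /QS; apply: bcE.
  - by rewrite {1}bE (fsum_seq uQ QS).
  - by move=> p q x y /QS Sp /QS Sq pq; apply: (fneq p q) => //; apply/eqP.
  - by move=> p x y /QS Sp hx hy; apply/A01E/(fsq p).
  - by apply/A01E/f01.
  - by move=> p x /QS Sp hx; have [] := fact p Sp b0 x A01b0 hx.
  - by move=> p x /QS Sp hx; have [] := fact p Sp b0 x A01b0 hx.
  - move=> B sB Ba Bb x; have : gen_subalgebra mul [set a; b] x by rewrite genA.
    by apply=> // y [->|->].
exists Q; split=> // p; split=> [[Sp [z z0 hz]]|pQ].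
  have [_ nS] := Sp; apply: (eigenspace_index H _ _ hz z0).
    by apply/eqP => p1; apply: nS; right.
  by apply/eqP => p0; apply: nS; left.
by split; [exact: QS | exists (bc p); [exact: (v_neq0 H) | exact: (v_eig H)]].
Qed.

(** Serves both to clear denominators in [E2] and [E3] and to show that a linear equation with
    nonzero slope has a unique solution. *)
Lemma eq_scaled (F : fieldType) (c x y x' y' : F) :
  c != 0 -> x' - y' = c * (x - y) -> (x = y <-> x' = y').
Proof.
move=> c0 E; split=> [xy|/eqP].
  by apply/eqP; rewrite -subr_eq0 E xy subrr mulr0.
by rewrite -subr_eq0 E mulf_eq0 (negPf c0) subr_eq0 => /eqP.
Qed.

(** * Translation of the equations in (k, g) into the structure of A_{rho, rho}(b) *)

Theorem theorem3p28 (F : fieldType) (A : lmodType F)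
  (mul : {bilinear A -> A -> A}) (a b : A)
  (charF : 2%N \notin [pchar F])
  (genA : gen_subalgebra mul [set a; b] = [set: A])
  (dimA : dim_ge [set: A] 3)
  (axa : is_axis mul a) (wpa : weakly_primitive mul a)
  (fra : fusion_rules mul a) (dim0 : dim_eq (eig mul a 0) 1)
  (axb : is_axis mul b)
  (alphab : F) (b0 : A) (bc : F * F -> A)
  (decb : decomposes mul a b alphab b0 bc) (b0_neq0 : b0 != 0)
  (theta1 theta0 theta1' theta0' : F)
  (thetaE : \sum_(p \in Saxis mul a) (p.1 *: mul (bc p) (bc p)) =
            theta1 *: a + theta0 *: b0)
  (theta'E : \sum_(p \in Saxis mul a) mul (bc p) (bc p) =
             theta1' *: a + theta0' *: b0)
  (rho : F) (rho_neq : rho != 2^-1) :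
  let comm := commutative_alg mul in
  let Sc := Scirc mul a in
  let Sd := Sdag mul a in
  let yr := yvec mul a bc rho in
  let yr' := yvec' mul a alphab b0 bc rho in
  let Abr := eig mul b rho in
  (* y is a nonzero (rho, rho)-eigenvector of b with the given coefficients *)
  let evec y alphay gamma0 (gamma : F * F -> F) :=
    y = alphay *: a + gamma0 *: b0 + \sum_(p \in Sc) (gamma p *: bc p) /\
    is_eigvec mul b rho y in
  let cond1 := theta0 = 0 in
  let cond2 := rho - alphab = 2 / (2 * rho - 1) * theta1 in
  let cond3 := ~ comm -> rho = alphab in
  let E1 p alphay g := g = (eps p * (alphay - alphab) + 1) / (2 * rho - 1) in
  let E2 alphay :=
    0 = alphay * (alphab + 2 / (2 * rho - 1) * theta1 - rho)
        + (alphab - alphab ^+ 2)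
        - 2 * alphab / (2 * rho - 1) * theta1
        + 2 * (1 - rho) / (2 * rho - 1) * theta1' in
  let E2' alphay :=
    2 * theta1 * (alphay - alphab) =
      (alphay - alphab) * (rho - alphab) * (2 * rho - 1)
      + alphab * (rho - 1) * (2 * rho - 1) + 2 * (rho - 1) * theta1' in
  let E3 alphay :=
    0 = 2 * theta0 / (2 * rho - 1) * alphay + (1 - rho)
        - 2 * alphab * theta0 / (2 * rho - 1)
        + 2 * (1 - rho) / (2 * rho - 1) * theta0' in
  let E3' alphay :=
    2 * theta0 * (alphay - alphab) =
      (2 * rho - 1) * (rho - 1) + 2 * (rho - 1) * theta0' in
  let E4 g := (rho - alphab) * g = 1 - alphab in
  [/\ 2 *: (theta1 *: a + theta0 *: b0) =
        \sum_(p \in Saxis mul a) (eps p *: mul (bc p) (bc p)),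

      (* (i) *)
      (forall y alphay gamma0 gamma, evec y alphay gamma0 gamma ->
         gamma0 = 0 ->
         [/\ alphay != 0,
             forall p, Sc p -> gamma p = eps p / (2 * rho - 1) * alphay,
             y = alphay *: yr,
             theta0 = 0 /\ rho - alphab = 2 / (2 * rho - 1) * theta1 &
             Sd !=set0 -> rho = alphab]) /\
      (cond1 -> cond2 -> cond3 -> is_eigvec mul b rho yr),

      (* (ii) *)
      [/\ (forall y alphay gamma0 gamma, evec y alphay gamma0 gamma ->
             gamma0 = 1 ->
             y = (alphay - alphab) *: yr + yr' /\ dim_le Abr 2),
          (* (a) *)
          (forall y alphay gamma0 gamma, evec y alphay gamma0 gamma ->
             gamma0 = 1 ->
             [/\ forall p, Sc p -> E1 p alphay (gamma p),
                 E2 alphay /\ (forall x, E2 x <-> E2' x),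
                 E3 alphay /\ (forall x, E3 x <-> E3' x) &
                 forall p, Sd p -> E4 (gamma p)]),
          (* (b) *)
          (rho = 1 -> yr' = b /\ eig mul b 1 b) /\
          (rho != 1 ->
             (Abr yr' <->
              [/\ theta0' = 2^-1 - rho, theta1' = alphab * (2^-1 - rho) &
                  ~ comm -> alphab = 2^-1])) &
          (* (c); "given by an equation" = "is its unique solution" *)
          (forall y alphay gamma0 gamma, evec y alphay gamma0 gamma ->
             gamma0 = 1 -> ~ Abr yr ->
             [/\ rho - alphab <> 2 / (2 * rho - 1) * theta1 ->
                   (forall x, E2 x <-> x = alphay) /\
                   (forall p, Sc p -> forall g, E1 p alphay g <-> g = gamma p),
                 theta0 <> 0 ->
                   (forall x, E3 x <-> x = alphay) /\
                   (forall p, Sc p -> forall g, E1 p alphay g <-> g = gamma p) &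
                 rho - alphab = 2 / (2 * rho - 1) * theta1 -> theta0 = 0 ->
                   [/\ ~ comm, rho <> alphab,
                       forall p, Sd p -> forall g, E4 g <-> g = gamma p,
                       alphay = alphab \/
                         (exists2 p, Sd p &
                            forall x, E1 p x (gamma p) <-> x = alphay) &
                       forall p, Sc p ->
                         forall g, E1 p alphay g <-> g = gamma p]])] &

      (* (iii) *)
      [/\ (* (a) *)
          dim_eq Abr 2 <-> Abr = addsp (line yr) (line yr'),
          (* (b) *)
          Abr = line yr <-> [/\ cond1, cond2, cond3 & ~ Abr yr'],
          (* (c) *)
          (~ comm -> dim_eq Abr 2 -> rho = alphab /\ alphab = 1) /\
          (eig mul b 1 =
             addsp (line b)
                   (line (a + \sum_(p \in Saxis mul a) (eps p *: bc p))) <->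
           \sum_(p \in Saxis mul a) (p.1 *: mul (bc p) (bc p)) =
             ((1 - alphab) / 2) *: a),
          (* (d) *)
          [/\ rho != 1 ->
                (dim_eq Abr 2 <->
                 [/\ theta0 = 0,
                     rho = 2^-1 - theta0',
                     rho = alphab + 2 / (2 * rho - 1) * theta1 &
                     alphab != 0 -> rho = 2^-1 - theta1' / alphab]),
              rho != 1 -> dim_eq Abr 2 -> comm &
              forall r1 r2 : F,
                r1 != 2^-1 -> r1 != 1 -> dim_eq (eig mul b r1) 2 ->
                r2 != 2^-1 -> r2 != 1 -> dim_eq (eig mul b r2) 2 ->
                r1 = r2] &
          (* (e) *)
          (theta0 <> 0 ->
             (forall rs : seq F, uniq rs ->
                (forall r, r \in rs ->
                   [/\ r != 2^-1, r != 1 & exists z, is_eigvec mul b r z]) ->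
                (size rs <= 3)%N) /\
             (forall y alphay gamma0 gamma, evec y alphay gamma0 gamma ->
                dim_eq Abr 1)) /\
          (* (f) *)
          (theta0 = 0 -> rho != 1 ->
             forall y alphay gamma0 gamma, evec y alphay gamma0 gamma ->
               (gamma0 <> 0 -> rho = 2^-1 - theta0') /\
               (rho - alphab <> 2 / (2 * rho - 1) * theta1 ->
                  rho = 2^-1 - theta0' /\ dim_eq Abr 1))]].
Proof.
move=> comm Sc Sd yr yr' Abr evec cond1 cond2 cond3 E1 E2 E2' E3 E3' E4.
have [Q [H QS S0 ScQ]] := axis_pair_exists charF genA dimA axa wpa fra dim0 axb decb b0_neq0.
have h2 := two_neq0 H.
have sumS (f : F * F -> A) : (forall p, bc p = 0 -> f p = 0) ->
    \sum_(p \in Saxis mul a) f p = \sum_(p <- Q) f p.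
  by move=> f0; apply: (fsum_seq (uniqQ H) QS) => p Sp /(S0 p Sp)/f0.
have sumSc (gam : F * F -> F) : \sum_(p \in Sc) (gam p *: bc p) = \sum_(p <- Q) gam p *: bc p.
  by apply: (fsum_seq (uniqQ H)) => [p /ScQ //|p /ScQ ->].
have sq0 p : bc p = 0 -> mul (bc p) (bc p) = 0 by move=> ->; rewrite mul0v.
have thE := thetaE; rewrite sumS in thE; last by move=> p /sq0->; rewrite scaler0.
have th'E := theta'E; rewrite sumS in th'E; last exact: sq0.
have SdQ p : Sd p <-> p \in Q /\ del p != 0.
  rewrite /Sd /Sdag /= /del subr_eq0; split=> [[/ScQ pQ ?]|[pQ ?]] //.
  by split=> //; apply/ScQ.
have ncSd : ~ comm <-> Sd !=set0.
  rewrite /comm (noncommutative_del H); split=> [[p pQ dp]|[p /SdQ[pQ dp]]].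
    by exists p; apply/SdQ.
  by exists p.
have neq (r : F) : r != 2^-1 -> 2 * r - 1 != 0.
  by apply: contra; rewrite subr_eq0 => /eqP h; apply/eqP; apply: (mulfI h2); rewrite h divff.
have yrE r : yvec mul a bc r = zvec a b0 alphab Q bc r 1 0.
  rewrite /yvec zvecE scale1r scale0r addr0 sumS // => p ->.
  by rewrite scaler0.
have yr'E r : yvec' mul a alphab b0 bc r = zvec a b0 alphab Q bc r 0 1.
  by rewrite /yvec' zvecE scale1r scale0r add0r sumS.
have eig0 r : eig mul b r 0 by exact: eig2_0.
have eig_lin r k x y : eig mul b r x -> eig mul b r y -> eig mul b r (k *: x + y).
  by move=> hx hy; apply: eig2D => //; apply: eig2Z.
have indep r := @zvec_inj0 _ _ _ _ _ _ _ _ _ H r.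
have span r : r != 2^-1 -> forall x, eig mul b r x ->
    exists k g, x = k *: zvec a b0 alphab Q bc r 1 0 + g *: zvec a b0 alphab Q bc r 0 1.
  move=> /neq rn x /(eig_is_zvec H rn)[k [g ->]].
  by exists k, g; apply: zvec_lin.
have dim2 r : r != 2^-1 -> dim_eq (eig mul b r) 2 <->
    eig mul b r (zvec a b0 alphab Q bc r 1 0) /\ eig mul b r (zvec a b0 alphab Q bc r 0 1).
  by move=> rn; exact: (dim_eq2P (indep r) (eig0 r) (@eig_lin r) (span r rn)).
have rn := neq _ rho_neq.
have coef y al g gam : evec y al g gam ->
    [/\ y != 0, y = zvec a b0 alphab Q bc rho (al - g * alphab) g,
      forall p, p \in Q -> gam p = gcoef rho (al - g * alphab) g p,
      [/\ eig mul b rho y, K1 alphab theta1 theta1' rho (al - g * alphab) g = 0 &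
      K0 theta0 theta0' rho (al - g * alphab) g = 0] &
      forall p, p \in Q -> KD mul b0 alphab bc rho (al - g * alphab) g p = 0].
  rewrite /evec sumSc => -[yE [y0 hy]].
  by have [? ? ? ? ?] := eigenvector_coef H thE th'E rn yE hy.
have Yr := eig_zvec10 H thE th'E rn.
have Yr' := eig_zvec01 H thE th'E rn.
have c123 := cond12_cond3 H thE (rho := rho).
have nc_dim2 : ~ comm -> dim_eq Abr 2 -> rho = alphab /\ alphab = 1.
  move=> nc /(dim2 rho rho_neq)[/Yr[e0 e1] hY].
  have re := c123 e0 e1 nc; split=> //; rewrite -re.
  (* If rho were not 1, y'_rho would force alpha_b = 1/2, hence rho = 1/2. *)
  have [//|/Yr' [/(_ hY)[_ _ /(_ nc) h] _]] := eqVneq rho 1.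
  by move: rho_neq; rewrite re h eqxx.
rewrite /yr /yr' /Abr /cond1 /cond2 /cond3 yrE yr'E.
split.
- have -> : \sum_(p \in Saxis mul a) (eps p *: mul (bc p) (bc p)) =
    \sum_(p <- Q) (eps p *: mul (bc p) (bc p)).
    by apply: sumS => p /sq0->; rewrite scaler0.
  by rewrite (eps_sq_sum H thE).
- split=> [y al g gam /coef[y0 yE gE [hy _ _] kd] g0|e0 e1 e2]; last first.
    by split; [exact: (zvec10_neq0 H) | apply/Yr].
  rewrite g0 mul0r subr0 in yE gE.
  have yE' : y = al *: zvec a b0 alphab Q bc rho 1 0.
    by rewrite yE zvec_lin scale0r addr0.
  have al0 : al != 0 by apply: contraNneq y0 => al0; rewrite yE' al0 scale0r.
  (* Dividing y by alpha_y shows that y_rho itself is an eigenvector. *)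
  have /Yr[e0 e1] : eig mul b rho (zvec a b0 alphab Q bc rho 1 0).
    have := eig_lin rho al^-1 _ _ hy (eig0 rho).
    by rewrite yE' addr0 scalerA mulVf // scale1r.
  split=> // [p /ScQ pQ|/ncSd]; last exact: c123.
  by rewrite gE // /gcoef addr0; field.
- split.
  + move=> y al g gam /coef[_ yE _ _ _] g1; rewrite g1 mul1r in yE.
    split; first by rewrite yE zvec_lin scale1r.
    exact: (plane_dim_le2 (indep rho) (eig0 rho) (@eig_lin rho) (span rho rho_neq)).
  + move=> y al g gam /coef[_ _ gE [_ k1 k0] kd] g1.
    rewrite g1 mul1r in gE k1 k0 kd; split.
    * by move=> p /ScQ pQ; rewrite /E1 gE // /gcoef; field.
    * split=> [|x]; rewrite /E2 ?/E2'; first by apply/esym; rewrite -k1 /K1; field.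
      by apply: (eq_scaled (c := - (2 * rho - 1))); [rewrite oppr_eq0 | field].
    * split=> [|x]; rewrite /E3 ?/E3'; first by apply/esym; rewrite -k0 /K0; field.
      by apply: (eq_scaled (c := - (2 * rho - 1))); [rewrite oppr_eq0 | field].
    * move=> p /SdQ[pQ dp]; rewrite /E4 gE //.
      by rewrite (KD_E4 H rn pQ dp (kd p pQ)) mul1r.
  + split=> [r1|r1]; last exact: (Yr' r1).
    split; last by split; rewrite /eigL /eigR /= scale1r (bb H).
    rewrite [RHS](bE H) zvecE scale0r add0r scale1r r1.
    by rewrite mulr1 [2 - 1]addrK invr1 scale1r.
  + move=> y al g gam /coef[_ _ gE [_ k1 k0] kd] g1 nYr.
    rewrite g1 mul1r in gE k1 k0 kd.
    have E1u p : Sc p -> forall h, E1 p al h <-> h = gam p.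
      move=> /ScQ pQ h; rewrite /E1 gE // /gcoef.
      have -> // : (2 * rho - 1)^-1 * (eps p * (al - alphab) + 1) =
        (eps p * (al - alphab) + 1) / (2 * rho - 1) by rewrite mulrC.
    (* The equations of the third case make y_rho an eigenvector by [Yr], contrary to [nYr]. *)
    split=> [c2|t0|c2 t0]; last by case: nYr; apply/Yr.
    * split=> // x; rewrite /E2.
      (* By [k1], alpha_y solves [E2], so the right side of [E2] at x is the slope times x -
         alpha_y; [c2] makes the slope nonzero. *)
      apply: iff_sym; apply: (eq_scaled (c := - (alphab + 2 / (2 * rho - 1) * theta1 - rho))).
        apply/eqP => /eqP; rewrite oppr_eq0 => /eqP c; apply: c2.
        by apply/eqP; rewrite -subr_eq0 -oppr_eq0 -[X in _ == X]c; apply/eqP; ring.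
      by rewrite -[LHS]addr0 -[X in _ + X]k1 /K1; field.
    * split=> // x; rewrite /E3.
      apply: iff_sym; apply: (eq_scaled (c := - (2 * theta0 / (2 * rho - 1)))).
        by rewrite oppr_eq0 !mulf_eq0 (negPf h2) invr_eq0 (negPf rn) orbF; apply/eqP.
      by rewrite -[LHS]addr0 -[X in _ + X]k0 /K0; field.
- split.
  + rewrite (dim2 rho rho_neq).
    exact: iff_sym (addsp_planeP (eig0 rho) (@eig_lin rho) (span rho rho_neq)).
  + rewrite (line_planeP (indep rho) (eig0 rho) (@eig_lin rho) (span rho rho_neq)) Yr.
    by split=> [[[e0 e1] nY]|[e0 e1 _ nY]]; split=> //; exact: c123.
  + split=> //.
    have n1 : (1 : F) != 2^-1.
      apply/eqP => h; have := congr1 (fun x => 2 * x - 1) h.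
      by rewrite mulr1 divff // subrr [2 - 1]addrK => /eqP; rewrite oner_eq0.
    (* At rho = 1 the factor 2 rho - 1 is 1, so y'_rho is b. *)
    have Eb : zvec a b0 alphab Q bc 1 0 1 = b.
      rewrite [RHS](bE H) zvecE scale0r add0r scale1r.
      by rewrite mulr1 [2 - 1]addrK invr1 scale1r.
    have Ey : a + \sum_(p \in Saxis mul a) (eps p *: bc p) = zvec a b0 alphab Q bc 1 1 0.
      rewrite -yrE /yvec; congr (_ + _).
      by rewrite mulr1 [2 - 1]addrK invr1 scale1r.
    rewrite Ey thetaE.
    have sp x : eig mul b 1 x -> exists k g,
        x = k *: b + g *: zvec a b0 alphab Q bc 1 1 0.
      move=> /(span 1 n1)[k [g ->]]; exists g, k; rewrite Eb addrC //.
    rewrite (addsp_planeP (eig0 1) (@eig_lin 1) sp) (eig_zvec10 H thE th'E (neq 1 n1)).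
    rewrite mulr1 [2 - 1]addrK divr1; split=> [[_ [-> e1]]|E].
      by rewrite scale0r addr0 e1 mulrC mulKf.
    split; first by split; rewrite /eigL /eigR /= scale1r (bb H).
    have [-> ->] : theta1 = (1 - alphab) / 2 /\ theta0 = 0.
      by apply: (A01_inj H); rewrite E scale0r addr0.
    by rewrite mulrC divfK.
  + split=> [r1|r1|r1 r2 n1 r11 /(dim2 r1 n1)[_ h1] n2 r21 /(dim2 r2 n2)[_ h2']].
    * rewrite (dim2 rho rho_neq) Yr (Yr' r1).
      split=> [[[e0 e1] [e0' e1' nc]]|[e0 e0' e1 e1']].
        split=> // [||ab0].
        - by rewrite e0' opprB addrC subrK.
        - by rewrite -e1 addrC subrK.
        - by rewrite e1' mulrC mulKf // opprB addrC subrK.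
      have e1b : rho - alphab = 2 / (2 * rho - 1) * theta1 by rewrite {1}e1 addrC addKr.
      have e0b : theta0' = 2^-1 - rho by rewrite e0' opprB addrC subrK.
      have e1b' : theta1' = alphab * (2^-1 - rho).
        (* For alpha_b = 0 the required value of theta_1' is 0, supplied by diagonalizability of L_b
           + R_b through [th1'_beta0]. *)
        have [ab|ab] := eqVneq alphab 0.
          by rewrite (th1'_beta0 H thE th'E rn axb r1 ab e0 e1b e0b) ab mul0r.
        by rewrite {1}(e1' ab) opprB addrC subrK mulrC divfK.
      split=> //; split=> // nc; apply: (noncommutative_th' H th'E nc).
        by rewrite e1b' e0b.
      by rewrite e0b subr_eq0 eq_sym.
    * move=> hd; apply: contrapT => nc; have [re ab1] := nc_dim2 nc hd.
      by move: r1; rewrite re ab1 eqxx.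
    * have [e1 _ _] := (eig_zvec01 H thE th'E (neq _ n1) r11).1 h1.
      have [e2 _ _] := (eig_zvec01 H thE th'E (neq _ n2) r21).1 h2'.
      by apply/oppr_inj/(addrI 2^-1); rewrite -e1 -e2.
  (* Without y_rho in the eigenspace, y has a nonzero y'_rho-coordinate g, and [plane_dim1] makes
     the eigenspace a line. *)
  + have dim1 y al g gam : evec y al g gam ->
        ~ eig mul b rho (zvec a b0 alphab Q bc rho 1 0) ->
        g != 0 /\ dim_eq (eig mul b rho) 1.
      move=> /coef[y0 yE _ [hy _ _] _] nY.
      have g0 : g != 0.
        apply/negP => /eqP g0; apply: nY; rewrite g0 mul0r subr0 in yE.
        have yE' : y = al *: zvec a b0 alphab Q bc rho 1 0.
          by rewrite yE zvec_lin scale0r addr0.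
        have al0 : al != 0 by apply: contraNneq y0 => al0; rewrite yE' al0 scale0r.
        have := eig_lin rho al^-1 _ _ hy (eig0 rho).
        by rewrite yE' addr0 scalerA mulVf // scale1r.
      split=> //; apply: (plane_dim1 (k := al - g * alphab) (indep rho) (eig0 rho) (@eig_lin rho)
        (span rho rho_neq) g0) => //.
      by rewrite -zvec_lin -yE.
    split=> [t0|t0 r1 y al g gam ev].
      split=> [rs urs rsP|y al g gam ev].
        apply: (cubic_roots (b := alphab) (t1 := theta1) (t0 := theta0)
                  (t1' := theta1') (t0' := theta0') h2 urs) => r /rsP[rn2 r1 [z [z0 hz]]].
        have rn' := neq r rn2; have [k [g zE]] := eig_is_zvec H rn' hz.
        rewrite zE in hz z0; have [k1 k0 _] := (eig_zvec H thE th'E rn' k g).1 hz.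
        (* With g = 0, [K0] = 0 reduces to k theta_0 = 0, so z would vanish. *)
        have g0 : g != 0.
          apply: contraNneq z0 => g0; rewrite g0 /K0 !mul0r addr0 in k0.
          have k00 : k = 0.
            apply/eqP; move/eqP: k0; rewrite !mulf_eq0 (negPf h2) invr_eq0 (negPf rn').
            by move/eqP/negPf: t0 => ->; rewrite orbF.
          by rewrite g0 k00 zvec_lin !scale0r addr0.
        apply/eqP; rewrite -subr_eq0; apply/eqP.
        have c0 : g * (1 - r) != 0 by rewrite mulf_neq0 // subr_eq0 eq_sym.
        apply: (mulfI c0); rewrite mulr0.
        (* Eliminating k between [K0] = 0 and [K1] = 0 leaves the relation of [cubic_roots] times g
           (1 - r); the square clears the denominators. *)
        transitivity ((2 * r - 1) ^+ 2 *
          ((alphab + 2 * (2 * r - 1)^-1 * theta1 - r) * K0 theta0 theta0' r k g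
           - 2 * (2 * r - 1)^-1 * theta0 * K1 alphab theta1 theta1' r k g)).
          by rewrite /K0 /K1; field.
        by rewrite k0 k1 !mulr0 subrr mulr0.
      by have [] := dim1 _ _ _ _ ev; first by move=> /Yr[].
    have gE : g <> 0 -> rho = 2^-1 - theta0'.
      move=> /eqP g0; have [_ _ _ [_ _ k0] _] := coef _ _ _ _ ev.
      move/eqP: k0; rewrite /K0 t0 mulr0 add0r !mulf_eq0 (negPf g0) subr_eq0 eq_sym.
      rewrite (negPf r1) /= => /eqP k0.
      have := congr1 (fun x => x * ((2 * rho - 1) / 2)) k0; rewrite mul0r => k0'.
      by apply/eqP; rewrite -subr_eq0 -k0'; apply/eqP; field; rewrite h2 rn.
    split=> // c2; have [|/eqP g0 ?] := dim1 _ _ _ _ ev; last by split=> //; exact: gE.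
    by move=> /Yr[].
Qed.
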